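(* Let $d\ge2$, $q\ge1$ and $p$ be fixed. Wired phase: suppose the wired phase is exponentially stable with constant $C_1$, WSM within the wired phase holds with constant $C_2$, and the local relaxation assumption holds with $\iota=\mathbf 1$ for a non-decreasing sequence $f(m)$. Then there exist $C_0,K_0$ depending only on $C_1,C_2$ (and $p,q,d$) such that, if $g_n$ is defined with $K=K_0$, then for every $t\ge0$, $$\|\mathbb P(\widehat X^{\mathbf 1}_{\mathbb T_n,t}\in\cdot)-\widehat\pi_n\|_{TV}\le C_0n^d\exp(-g_n(t)/C_0).$$ Free phase: likewise, if the free phase is exponentially stable with constant $C_1$, WSM within the free phase holds with constant $C_2$, and the local relaxation assumption holds with $\iota=\mathbf 0$ for a non-decreasing sequence $f(m)$, then for every $t\ge0$, $$\|\mathbb P(\check X^{\mathbf 0}_{\mathbb T_n,t}\in\cdot)-\check\pi_n\|_{TV}\le C_0n^d\exp(-g_n(t)/C_0).$$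
   Context: Random-cluster model: $\pi_{G,p,q}(\omega)\propto p^{|\omega|}(1-p)^{|E|-|\omega|}q^{|\mathrm{Comp}(\omega)|}$, $\omega\subseteq E$, with $\mathrm{Comp}(\omega)$ the set of connected components of $(V,\omega)$; a boundary condition is a partition of the boundary vertices, and components are then counted after identifying vertices in the same class. Free $\mathbf 0$: singletons; wired $\mathbf 1$: one class. As a configuration, $\mathbf 1$ (resp. $\mathbf 0$) is all-open (resp. all-closed). $\Lambda_r=[-\frac r2,\frac r2]^d\cap\mathbb Z^d$. $\mathbb T_n=(\mathbb Z/n\mathbb Z)^d$, with vertices identified with those of $\Lambda_n$ so that $\Lambda_r\subset\mathbb T_n$ for $r<n$. $\pi_n=\pi_{\mathbb T_n,p,q}$. Phases: fix a sufficiently small constant $\epsilon=\epsilon(p,q,d)>0$ independent of $n$. With $\mathcal C_1(\omega)$ the largest connected component, $\widehat\Omega=\{\omega\subset E(\mathbb T_n):|\mathcal C_1(\omega)|\ge\epsilon n^d\}$ (wired phase), $\check\Omega=\{\omega\subset E(\mathbb T_n):|\mathcal C_1(\omega)|\le\epsilon n^d\}$ (free phase), $\widehat\pi_n=\pi_n(\cdot\mid\widehat\Omega)$, $\check\pi_n=\pi_n(\cdot\mid\check\Omega)$. WSM within the wired phase with constant $C$: for all $n$ and $r\le n/2$, $\|\pi_{\Lambda_r^{\mathbf 1}}(\omega(\Lambda_{r/2})\in\cdot)-\widehat\pi_n(\omega(\Lambda_{r/2})\in\cdot)\|_{TV}\le Ce^{-r/C}$. WSM within the free phase: the same with $\mathbf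 1,\widehat\pi_n$ replaced by $\mathbf 0,\check\pi_n$. Exponential stability of the wired phase with constant $C_1$: $\pi_n(\partial\widehat\Omega\mid\widehat\Omega)\le C_1e^{-n^{d-1}/C_1}$, where $\partial\widehat\Omega$ is the set of configurations in $\widehat\Omega$ that are one edge-flip away from $\widehat\Omega^c$; for the free phase replace $\widehat\Omega$ by $\check\Omega$. FK dynamics (continuous time): each edge $e$ has an independent rate-1 Poisson clock; when it rings, given the current $\omega$, $e$ becomes open with probability $\frac p{q(1-p)+p}$ if it is a bridge in $\omega\cup\{e\}$ (i.e. its presence changes the number of components, taking boundary identifications into account) and with probability $p$ otherwise; else it becomes closed. $X_{t,A^\xi}^{\omega_0}$ is this chain on domain $A$ with boundary condition $\xi$ started from $\omega_0$. The restricted chain $\widehat X_t^{\omega_0}$ (resp. $\check X_t^{\omega_0}$) on $\mathbb T_n$ is the same except that any update taking the configuration out of $\widehat\Omega$ (resp. $\check\Omega$) is rejected. Local relaxation assumption for $\iota\in\{\mathbf 0,\mathbf 1\}$ and $f$: let $B_{m,e}$ be the subgraph of $\mathbb T_n$ induced by the vertices at $\ell_\infty$-distance at most $m$ from the edge $e$, and $B_{m,e}^\iota$ the same with $\iota$ boundary condition. For all $m=O(\log n)$ (i.e., for some constant $A>0$, for all $n$ and all $m\le A\log n$) and all $t>0$, $\max_{e\in E(\mathbb T_n)}\|\mathbb P(X^\iota_{t,B_{m,e}^\iota}(e)\in\cdot)-\pi_{B_{m,e}^\iota}(\omega_e\in\cdot)\|_{TV}\le e^{-t/f(m)}$. Given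 $f$ and a constant $K$: $g_n(t)=\max\{m\le n: m f(m)\le\min(t,e^{n^{d-1}/K})\}$. *)

(* Defs.v *)
From mathcomp Require Import all_boot all_order all_algebra.
From mathcomp Require Import all_classical all_reals all_analysis.
From mathcomp Require Import ring.

Set Implicit Arguments.
Unset Strict Implicit.
Unset Printing Implicit Defensive.

Import Order.TTheory GRing.Theory Num.Theory numFieldNormedType.Exports.
Local Open Scope ring_scope.

(* A law on a finite set is given by its probability mass function. *)
Section FiniteLaws.
Context {R : realType} {T U : finType}.

Definition tv (mu nu : T -> R) : R := 2^-1 * \sum_x `|mu x - nu x|.

Definition law_of (X : T -> U) (mu : T -> R) (y : U) : R :=
  \sum_(x | X x == y) mu x.

Definition prob (mu : T -> R) (S : {set T}) : R := \sum_(x in S) mu x.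

Definition conditional (mu : T -> R) (S : {set T}) (x : T) : R :=
  if x \in S then mu x / prob mu S else 0.

End FiniteLaws.

Section PoissonClocks.
Context {R : realType} {I T : finType}.
Variables (E : {set I}) (k : I -> T -> T -> R).

(* The law after one update along the kernel of a uniformly chosen clock. *)
Definition ring_step (mu : T -> R) (y : T) : R :=
  \sum_(i in E) #|E|%:R^-1 * \sum_x mu x * k i x y.

(* Law at time t of the chain started from x0 in which every i in E carries
   an independent rate-1 Poisson clock and the state is updated by k i when the
   clock of i rings.  The superposition of the clocks is a Poisson process of
   rate #|E| whose successive rings have independent labels uniform in E: the
   number of rings before t is Poisson(#|E| t), and is independent of the
   labels.  (poisson_pmf of the library is not used because it is not a
   probability mass function when its rate is 0.) *)
Definition clock_law (x0 : T) (t : R) (y : T) : R :=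
  \big[+%R/0]_(0 <= j <oo) (expR (- (#|E|%:R * t)) * exp_coeff (#|E|%:R * t) j
    * iter j ring_step (fun x => (x == x0)%:R) y).

End PoissonClocks.

Section ForwardEquation.
Context {R : realType} {I T : finType}.
Context (E : {set I}) (k : I -> T -> T -> R).
Context (k_ge0 : forall i x y, 0 <= k i x y).
Context (k_sum1 : forall i x, \sum_y k i x y = 1).

Let M : R := #|E|%:R.
Let a (x0 : T) j := iter j (ring_step E k) (fun x => (x == x0)%:R).
Let c (b : nat -> R) j := M ^+ j * j`!%:R^-1 * b j.

Let a_ge0 x0 j y : 0 <= a x0 j y.
Proof.
elim: j y => [|j IH] y; first exact: ler0n.
apply: sumr_ge0 => i _; apply: mulr_ge0; first by rewrite invr_ge0.
by apply: sumr_ge0 => x _; exact: mulr_ge0.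
Qed.

Let a_sum x0 j : \sum_y a x0 j y <= 1.
Proof.
elim: j => [|j IH].
  by rewrite (bigD1 x0)//= eqxx big1 ?addr0// => y /negPf ->.
rewrite /a iterS /ring_step exchange_big/= (eq_bigr (fun=> M^-1 * \sum_y a x0 j y)).
  rewrite sumr_const -mulr_natl mulrA -/M.
  have [->|M0] := eqVneq M 0; first by rewrite !mul0r.
  by rewrite divff// mul1r.
move=> i _; rewrite -mulr_sumr exchange_big/=; congr (_ * _).
by apply: eq_bigr => x _; rewrite -mulr_sumr k_sum1 mulr1.
Qed.

Let a_le1 x0 j y : `|a x0 j y| <= 1.
Proof.
rewrite ger0_norm//; apply: le_trans (a_sum x0 j).
by rewrite (bigD1 y)//= lerDl sumr_ge0.
Qed.

Let cvg_c b t : (forall j, `|b j| <= 1) -> cvgn (pseries (c b) t).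
Proof.
move=> b1; apply: normed_cvg.
apply: (@series_le_cvg _ _ (exp_coeff (M * `|t|))) => [j|j|j|].
- exact: normr_ge0.
- by rewrite exp_coeff_ge0// mulr_ge0// ler0n.
- have p0 : 0 <= (M * `|t|) ^+ j / j`!%:R.
    by rewrite mulr_ge0 ?invr_ge0 ?exprn_ge0 ?mulr_ge0 ?ler0n.
  rewrite /c /exp_coeff/= -[leRHS]mulr1 !normrM !normrX (ger0_norm (ler0n _ _ : 0 <= M)).
  rewrite (@ger0_norm _ (_^-1)) ?invr_ge0// mulrAC [X in X * _]mulrAC -exprMn.
  exact: ler_wpM2l.
- exact: is_cvg_series_exp_coeff.
Qed.

Let diffs_c b : pseries_diffs (c b) = c (fun j => M * b j.+1).
Proof.
apply/funext => j; rewrite /pseries_diffs /c factS natrM invfM exprS.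
have J0 : j.+1%:R != 0 :> R by rewrite pnatr_eq0.
have := mulfV J0; set u := j.+1%:R; set v := u^-1; set w := _^-1 => uv.
rewrite -[RHS]mul1r -uv; ring.
Qed.

Let pseries_Z r b t : pseries (c (fun j => r * b j)) t = r \*: pseries (c b) t.
Proof.
apply/funext => m; rewrite /pseries /series /= /GRing.scale/= mulr_sumr.
by apply: eq_bigr => j _; rewrite /c; ring.
Qed.


Let S b t : R := limn (pseries (c b) t).

Let S_sum (w : T -> R) (b : T -> nat -> R) t : (forall x j, `|b x j| <= 1) ->
  S (fun j => \sum_x w x * b x j) t = \sum_x w x * S (b x) t.
Proof.
move=> b1; apply/cvg_lim => //.
rewrite (_ : pseries _ t = fun m => \sum_x w x * pseries (c (b x)) t m); last first.
  apply/funext => m; rewrite /pseries /series /= (eq_bigr (fun j => \sum_x w x * (c (b x) j * t ^+ j))).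
    by rewrite exchange_big/=; apply: eq_bigr => x _; rewrite mulr_sumr.
  move=> j _; rewrite /c mulr_sumr mulr_suml; apply: eq_bigr => x _.
  by ring.
apply: cvg_big => [|x _]; first exact: add_continuous.
by apply: cvgMl_tmp; exact: cvg_c.
Qed.

Let S_derive b t : (forall j, `|b j| <= 1) ->
  is_derive t (1 : R) (S b) (M * S (fun j => b j.+1) t).
Proof.
move=> b1.
have Z r (b' : nat -> R) s : (forall j, `|b' j| <= 1) ->
    cvgn (pseries (c (fun j => r * b' j)) s).
  by move=> b'1; rewrite pseries_Z; apply: is_cvgZl_tmp; exact: cvg_c.
have -> : M * S (fun j => b j.+1) t = limn (pseries (pseries_diffs (c b)) t).
  by rewrite diffs_c pseries_Z limZl_tmp //; exact: cvg_c.
apply: (@pseries_snd_diffs _ _ (`|t| + 1)); rewrite ?diffs_c.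
- exact: cvg_c.
- exact: Z.
- rewrite (pseries_Z M (fun j => M * b j.+2)); apply: is_cvgZl_tmp; exact: Z.
- by rewrite [ltRHS]ger0_norm ?ltrDl// addr_ge0.
Qed.

Let clock_lawE x0 t y :
  clock_law E k x0 t y = expR (- (M * t)) * S (fun j => a x0 j y) t.
Proof.
apply/cvg_lim => //.
rewrite (_ : (fun _ => _) = expR (- (M * t)) \*: pseries (c (fun j => a x0 j y)) t).
  by apply: cvgZl_tmp; exact: cvg_c.
apply/funext => m; rewrite /pseries /series /= /GRing.scale/= mulr_sumr.
apply: eq_bigr => j _; rewrite -mulrA; congr (_ * _).
rewrite /exp_coeff /c /= exprMn -/M -/(a x0 j y). by ring.
Qed.

(* The next two lemmas check clock_law: its value at time 0, and Kolmogorov's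
   forward equation for the generator \sum_(i in E) (k i - 1). *)
Lemma clock_law0 x0 y : clock_law E k x0 0 y = (y == x0)%:R.
Proof.
rewrite clock_lawE mulr0 oppr0 expR0 mul1r; apply/cvg_lim => //.
apply: cvg_near_cst; near=> m; rewrite /pseries /series /=.
have m0 : (0 < m)%N by near: m; exact: nbhs_infty_gt.
rewrite big_ltn// big1_seq ?addr0 /c ?expr0 ?fact0 ?invr1 ?mulr1 ?mul1r//.
by move=> j; rewrite mem_index_iota => /andP[_ /andP[j0 _]]; rewrite expr0n gtn_eqF// mulr0.
Unshelve. all: by end_near. Qed.

Lemma clock_law_forward x0 t y :
  is_derive t (1 : R) (fun s => clock_law E k x0 s y)
    (\sum_(i in E) (\sum_x clock_law E k x0 t x * k i x y - clock_law E k x0 t y)).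
Proof.
have -> : (fun s => clock_law E k x0 s y) =
    (expR \o (fun s => - (M * s))) * S (fun j => a x0 j y).
  by apply/funext => s; exact: clock_lawE.
have D1 := @S_derive (fun j => a x0 j y) t (a_le1 x0 ^~ y).
have D2 : is_derive t (1 : R) (fun s => - (M * s)) (- M).
  have -> : (fun s => - (M * s)) = (- M) \*: id by apply/funext => s; rewrite /= /GRing.scale/= mulNr.
  by rewrite -[X in is_derive _ _ _ X]mulr1; exact: (@is_deriveZ _ _ _ id (- M) t 1 1).
apply: is_derive_eq; rewrite /= /GRing.scale /=.
have -> : S (fun j => a x0 j.+1 y) t =
    \sum_x (\sum_(i in E) M^-1 * k i x y) * S (fun j => a x0 j x) t.
  rewrite -S_sum => [|x j]; last exact: a_le1.
  congr (S _ t); apply/funext => j; rewrite /a iterS /ring_step.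
  under eq_bigr do rewrite mulr_sumr.
  rewrite exchange_big/=; apply: eq_bigr => x _; rewrite mulr_suml.
  by apply: eq_bigr => i _; rewrite -mulrA mulrC [RHS]mulrC; ring.
rewrite sumrB sumr_const -mulr_natl -/M clock_lawE.
congr (_ + _); last by ring.
rewrite exchange_big !mulr_sumr /=; apply: eq_bigr => x _.
rewrite mulr_suml !mulr_sumr; apply: eq_bigr => i iE.
have M0 : M != 0 by rewrite pnatr_eq0 -lt0n; apply/card_gt0P; exists i.
by rewrite clock_lawE; field.
Qed.
End ForwardEquation.

(* Below, a graph has vertex set A and edge set E, its edges being two-element subsets
   of A; a configuration is a subset of E.  A boundary condition xi is a
   partition of a set of (boundary) vertices. *)

Section RandomCluster.
Context {R : realType} {V : finType}.
Implicit Types (A : {set V}) (E w : {set {set V}}) (xi : {set {set V}}).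

(* u and v are joined by an open edge or identified by xi. *)
Definition linked xi w : rel V :=
  [rel u v | ([set u; v] \in w) || [exists B in xi, (u \in B) && (v \in B)]].

Definition components A xi w : {set {set V}} :=
  equivalence_partition (connect (linked xi w)) A.

Definition largest_component A xi w : nat := \max_(B in components A xi w) #|B|.

Definition rc_weight (p q : R) A E xi w : R :=
  if w \subset E
  then p ^+ #|w| * (1 - p) ^+ (#|E| - #|w|) * q ^+ #|components A xi w|
  else 0.

Definition rc (p q : R) A E xi w : R :=
  rc_weight p q A E xi w / \sum_w' rc_weight p q A E xi w'.

Definition is_bridge A xi w (e : {set V}) : bool :=
  #|components A xi (e |: w)| != #|components A xi (w :\ e)|.

Definition open_prob (p q : R) A xi w (e : {set V}) : R :=
  if is_bridge A xi w e then p / (q * (1 - p) + p) else p.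

(* The update of the edge e, rejected if it leaves S. *)
Definition fk_update (p q : R) A xi (S : {set {set {set V}}}) (e : {set V})
    (w w' : {set {set V}}) : R :=
  let accept w1 := if w1 \in S then w1 else w in
  let a := open_prob p q A xi w e in
  a * (w' == accept (e |: w))%:R + (1 - a) * (w' == accept (w :\ e))%:R.

Definition fk_law (p q : R) A E xi (S : {set {set {set V}}}) :
    {set {set V}} -> R -> {set {set V}} -> R :=
  clock_law E (fk_update p q A xi S).

End RandomCluster.

Notation torus d n := {ffun 'I_d -> 'I_n}.
Notation config d n := {set {set torus d n}}.

Section Torus.
Context {d n : nat}.
Implicit Types (x y : torus d n) (A : {set torus d n}).

Definition unit_shift (i : 'I_d) x : torus d n :=
  [ffun j => if j == i then ordS (x j) else x j].

(* As a simple graph: no loops when n = 1, no double edges when n = 2. *)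
Definition torus_edges : {set {set torus d n}} :=
  [set e | [exists x : torus d n, [exists i, (e == [set x; unit_shift i x]) && (x != unit_shift i x)]]].

Definition induced_edges A : {set {set torus d n}} :=
  [set e in torus_edges | e \subset A].

Definition boundary A : {set torus d n} :=
  [set x in A | [exists y, (y \notin A) && ([set x; y] \in torus_edges)]].

(* |a| when a is identified with its representative in [-n/2, n/2]. *)
Definition cyc_norm (a : nat) : nat := minn a (n - a).

Definition cyc_dist (a b : 'I_n) : nat := cyc_norm ((a - b) + (b - a)).

(* Lambda_rho = [-rho/2, rho/2]^d, for rho < n. *)
Definition Lambda {R : realType} (rho : R) : {set torus d n} :=
  [set x : torus d n | [forall i, (cyc_norm (x i))%:R <= rho / 2]].

(* Vertices at l_infty distance at most m from an endpoint of e. *)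
Definition Ball (m : nat) (e : {set torus d n}) : {set torus d n} :=
  [set x : torus d n | [exists y in e, [forall i, cyc_dist (x i) (y i) <= m]]]%N.

End Torus.

Variant phase := Free | Wired.

Section Phases.
Context {R : realType}.
Variables (d : nat) (p q eps : R) (iota : phase).

Section Fixed_n.
Variable n : nat.
Implicit Types (A : {set torus d n}) (w : config d n).

Definition bc A : {set {set torus d n}} :=
  match iota with
  | Free => [set [set x] | x in boundary A]
  | Wired => [set boundary A]
  end.

Definition extremal A : config d n :=
  match iota with Free => finset.set0 | Wired => induced_edges A end.

(* pi_{A^iota}; the torus A = [set: torus d n] has empty boundary, hence no
   boundary identification. *)
Definition pi_dom A : config d n -> R := rc p q A (induced_edges A) (bc A).

(* Law at time t of the FK dynamics on A^iota started from iota. *)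
Definition X_law A (t : R) : config d n -> R :=
  fk_law p q A (induced_edges A) (bc A) [set: config d n] (extremal A) t.

Definition C1_size w : nat := largest_component [set: torus d n] finset.set0 w.

Definition Omega_phase : {set config d n} :=
  [set w : config d n | (w \subset torus_edges) &&
    match iota with
    | Free => (C1_size w)%:R <= eps * n%:R ^+ d
    | Wired => eps * n%:R ^+ d <= (C1_size w)%:R
    end].

Definition flip w (e : {set torus d n}) : config d n :=
  if e \in w then w :\ e else e |: w.

Definition Omega_boundary : {set config d n} :=
  [set w in Omega_phase |
    [exists e in torus_edges, flip w e \notin Omega_phase]].

Definition pi_torus : config d n -> R :=
  rc p q [set: torus d n] torus_edges finset.set0.

Definition pi_phase : config d n -> R := conditional pi_torus Omega_phase.

(* Law at time t of the dynamics restricted to the phase, started from iota. *)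
Definition X_phase_law (t : R) : config d n -> R :=
  fk_law p q [set: torus d n] torus_edges finset.set0 Omega_phase
    (extremal [set: torus d n]) t.

(* The torus exists and the measure conditioned on the phase is defined: the
   free phase is empty as soon as eps * n ^ d < 1. *)
Definition admissible : Prop := (0 < n)%N /\ Omega_phase != finset.set0.

(* omega(Lambda_rho): the restriction of omega to the edges of Lambda_rho. *)
Definition restrict_to (rho : R) w : config d n := w :&: induced_edges (Lambda rho).

End Fixed_n.

Definition WSM (C : R) : Prop :=
  forall n r : nat, admissible n -> r%:R <= n%:R / 2 :> R ->
    tv (law_of (restrict_to (r%:R / 2 : R)) (pi_dom (Lambda (r%:R : R) : {set torus d n})))
       (law_of (restrict_to (r%:R / 2 : R)) (@pi_phase n))
    <= C * expR (- (r%:R / C)).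

Definition exp_stable (C : R) : Prop :=
  forall n : nat, admissible n ->
    prob (@pi_phase n) (Omega_boundary n)
    <= C * expR (- (n%:R ^+ d.-1 / C)).

Definition local_relaxation (f : nat -> R) : Prop :=
  exists2 A : R, 0 < A &
    forall n m : nat, (0 < n)%N -> m%:R <= A * ln n%:R ->
    forall (t : R) (e : {set torus d n}), 0 < t -> e \in torus_edges ->
      tv (law_of (fun w : config d n => e \in w) (X_law (Ball m e) t))
         (law_of (fun w : config d n => e \in w) (pi_dom (Ball m e)))
      <= expR (- (t / f m)).

End Phases.

Arguments pi_phase {R} d p q eps iota n _.
Arguments X_phase_law {R} d p q eps iota n t _.

(* g_n(t); the set over which the maximum is taken contains 0 when t >= 0. *)
Definition g_ {R : realType} (d : nat) (f : nat -> R) (K : R) (n : nat) (t : R) : nat :=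
  \max_(m < n.+1 |
    m%:R * f m <= Num.min t (expR (n%:R ^+ d.-1 / K))) (m : nat).

(* Main.v *)
Require Import Defs.
From mathcomp Require Import all_boot all_order all_algebra.
From mathcomp Require Import all_classical all_reals all_analysis.
From mathcomp Require Import ring lra zify.
Set Implicit Arguments.
Unset Strict Implicit.
Unset Printing Implicit Defensive.
Import Order.TTheory GRing.Theory Num.Theory numFieldNormedType.Exports.
Local Open Scope ring_scope.

(** The chain is started from the extremal configuration of the phase: all edges open
    in the wired phase, all closed in the free phase. In the order that makes this
    configuration the largest one, the heat-bath updates are monotone, because a larger
    configuration has fewer bridges and [1 <= q], and the phase is closed under growth.

    Until it first tries to leave the phase, the restricted chain is the unrestricted
    one. The chain killed at this moment preserves nonnegative monotone observables, and
    such an observable is largest at the extremal configuration; so the killed chain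
    from the extremal state dominates the killed chain from the stationary law. For two
    laws in this relation the total variation is at most the sum over the edges of the
    discrepancies of the one-edge marginals ([count_minus_mono]). From the stationary
    law, the exit has probability at most (number of updates) * (weight of the
    boundary of the phase) ([stationary_exit]), which is negligible up to times of
    order exp (n ^ (d - 1) / K) by exponential stability. This gives [exit_estimate],
    and [phase_comparison] in continuous time.

    It remains to bound, for each edge, the discrepancy between the killed chain and the
    stationary law. Restricting the dynamics to a ball with the boundary condition of
    the phase only helps the edge to agree with the phase ([killed_le_ball]). In the
    ball the marginal relaxes to that of the ball measure by local relaxation; the
    hypothesis concerns logarithmic radii only, but a ball that does not wrap around the
    torus also sits in an enormous torus, where its radius is logarithmic
    ([local_relaxation_all_scales]). The ball measure is dominated by that of a smaller
    box by Holley's inequality ([holley]), and the box is compared with the phase by weak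
    spatial mixing ([pi_ball_le_phase]).

    With balls of radius about [g_ / 4] all errors are exponentially small in [g_]
    ([mixing_large]). Times beyond the exit scale are covered because the distance to
    the stationary law does not increase ([tv_clock_law_nincr]). *)

(** * Linear differential equations *)

Section LinearODE.
Context {R : realType} {T : finType}.

Lemma is_derive_fsum (P : pred T) (h : T -> R -> R) (dh : T -> R) (t : R) :
  (forall x, is_derive t (1 : R) (h x) (dh x)) ->
  is_derive t (1 : R) (fun s => \sum_(x | P x) h x s) (\sum_(x | P x) dh x).
Proof.
move=> H.
have -> : (fun s => \sum_(x | P x) h x s) = \sum_(x | P x) h x.
  by apply/funext => s; rewrite fct_sumE.
by elim/big_ind2 : _ => // [|u u' v v' ? ?]; [exact: is_derive_cst | exact: is_deriveD].
Qed.

(** Gronwall: the square norm of a solution grows at most exponentially, so it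
    cannot leave 0. Equalities between laws of continuous-time chains are obtained
    below by checking that both sides solve the same forward equation. *)
Lemma linear_ode_zero (L : T -> T -> R) (D : R -> T -> R) :
  (forall t y, is_derive t (1 : R) (D ^~ y) (\sum_x D t x * L x y)) ->
  (forall y, D 0 y = 0) -> forall t y, 0 <= t -> D t y = 0.
Proof.
move=> D' D0 t y t0.
pose C := \sum_x \sum_z `|L x z|.
pose F s := \sum_z D s z * D s z.
have C_ge x z : `|L x z| <= C.
  rewrite /C (bigD1 x)//= (bigD1 z)//= -addrA lerDl addr_ge0// sumr_ge0// => i _.
  by rewrite sumr_ge0.
have Fge0 s : 0 <= F s by apply: sumr_ge0 => z _; rewrite -expr2 sqr_ge0.
have Dle s z : D s z * D s z <= F s.
  by rewrite /F (bigD1 z)//= lerDl sumr_ge0// => i _; rewrite -expr2 sqr_ge0.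
pose dF s := \sum_z (D s z * (\sum_x D s x * L x z) + D s z * (\sum_x D s x * L x z)).
have F' s : is_derive s (1 : R) F (dF s).
  apply: is_derive_fsum => z.
  have := @is_deriveM R R (D ^~ z) (D ^~ z) s 1 _ _ (D' s z) (D' s z).
  exact.
pose N : R := #|T|%:R.
pose B := N * N * C *+ 2.
have dFle s : dF s <= B * F s.
  rewrite /dF /B.
  have H1 z x : D s z * (D s x * L x z) <= C * F s.
    have a1 : D s z * (D s x * L x z) <= `|D s z * D s x| * `|L x z|.
      by rewrite mulrA -normrM ler_norm.
    apply: le_trans a1 _; rewrite mulrC; apply: ler_pM => //.
    have h1 := Dle s z; have h2 := Dle s x.
    have h3 := sqr_ge0 (D s z - D s x); have h4 := sqr_ge0 (D s z + D s x).
    rewrite !expr2 in h3 h4.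
    by rewrite ler_norml; apply/andP; split; lra.
  apply: (@le_trans _ _ (\sum_(z : T) (\sum_(x : T) (C * F s) *+ 2))).
    apply: ler_sum => z _; rewrite -mulr2n mulr_sumr -sumrMnl; apply: ler_sum => x _.
    by rewrite lerMn2r orbC /= H1.
  have cst (c : R) : \sum_(z : T) c = N * c by rewrite sumr_const mulr_natl.
  rewrite (_ : \sum_(z : T) _ = N * (N * (C * F s *+ 2))) ?cst//.
  by rewrite le_eqVlt; apply/orP; left; apply/eqP; ring.
have E' s : is_derive s (1 : R) (fun s => expR (- (B * s))) (- B * expR (- (B * s))).
  have D2 : is_derive s (1 : R) (fun s => - (B * s)) (- B).
    have -> : (fun s => - (B * s)) = (- B) \*: id.
      by apply/funext => r; rewrite /= /GRing.scale/= mulNr.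
    by rewrite -[X in is_derive _ _ _ X]mulr1; exact: (@is_deriveZ _ _ _ id (- B) s 1 1).
  have -> : (fun s => expR (- (B * s))) = expR \o (fun s => - (B * s)) by [].
  by apply: is_derive_eq; rewrite /GRing.scale /= mulrC.
pose G := (fun s => expR (- (B * s))) * F.
have G' s : is_derive s (1 : R) G (expR (- (B * s)) * dF s + F s * (- B * expR (- (B * s)))).
  exact: (@is_deriveM R R _ _ s 1 _ _ (E' s) (F' s)).
have GF s : G s = expR (- (B * s)) * F s by [].
have Gle : G t <= G 0.
  apply: (@ler0_derive1_nincr _ G 0 t) => //.
  - move=> x _; rewrite derive1E (@derive_val _ _ _ _ _ _ _ (G' x)).
    rewrite (_ : _ + _ = expR (- (B * x)) * (dF x - B * F x)); last by ring.
    by rewrite pmulr_rle0 ?expR_gt0// subr_le0.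
  - apply: derivable_within_continuous => x _; by case: (G' x).
have G0 : G 0 = 0.
  by rewrite GF /F big1 ?mulr0// => z _; rewrite D0 mul0r.
have Ft : F t <= 0.
  move: Gle; rewrite G0 GF pmulr_rle0//; exact: expR_gt0.
have h : D t y * D t y <= 0 := le_trans (Dle t y) Ft.
apply/eqP; rewrite -sqrf_eq0 expr2 eq_le h/=.
by rewrite -expr2 sqr_ge0.
Qed.

End LinearODE.

(** * Laws driven by Poisson clocks *)

Section ClockLaw.
Local Open Scope classical_set_scope.
Local Open Scope ring_scope.
Context {R : realType} {I T : finType}.
Implicit Types (E : {set I}) (k : I -> T -> T -> R) (mu h : T -> R).

Definition expect mu h : R := \sum_x mu x * h x.

(** The action of one update on observables, dual to [ring_step]. All comparisons
    of dynamics are made on observables, where they are inequalities between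
    numbers, instead of couplings. *)
Definition step_op E k h (x : T) : R :=
  \sum_(i in E) #|E|%:R^-1 * \sum_y k i x y * h y.

Definition poisson_weight (r : R) (j : nat) : R := expR (- r) * exp_coeff r j.

Lemma poisson_weight_ge0 r j : 0 <= r -> 0 <= poisson_weight r j.
Proof. by move=> r0; rewrite mulr_ge0 ?expR_ge0// exp_coeff_ge0. Qed.

Lemma poisson_weight_cvg r :
  (fun m => \sum_(0 <= j < m) poisson_weight r j) @ \oo --> (1 : R).
Proof.
have -> : (fun m => \sum_(0 <= j < m) poisson_weight r j) =
    (fun m => expR (- r) * series (exp_coeff r) m).
  by apply/funext => m; rewrite /series /= mulr_sumr.
have -> : (1 : R) = expR (- r) * expR r by rewrite -expRD addNr expR0.
by apply: cvgMl_tmp; exact: is_cvg_series_exp_coeff.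
Qed.

Lemma poisson_weight_sum_le1 r m : 0 <= r -> \sum_(0 <= j < m) poisson_weight r j <= 1.
Proof.
move=> r0; apply: (cvgr_to_ge (poisson_weight_cvg r)).
near=> m'; have mm' : (m <= m')%N by near: m'; exact: nbhs_infty_ge.
by rewrite (big_cat_nat (leq0n m) mm')/= lerDl sumr_ge0// => j _; exact: poisson_weight_ge0.
Unshelve. all: by end_near. Qed.

(** Each term [j * w_j] equals [r * w_(j-1)], and the weights add up to 1. *)
Lemma poisson_mean_le r m : 0 <= r ->
  \sum_(0 <= j < m) poisson_weight r j * j%:R <= r.
Proof.
move=> r0; case: m => [|m]; first by rewrite big_nil.
rewrite big_nat_recl// mulr0 add0r.
rewrite (eq_bigr (fun j => r * poisson_weight r j)) => [|j _]; last first.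
  rewrite /poisson_weight /exp_coeff /= factS natrM exprS.
  have J0 : j.+1%:R != 0 :> R by rewrite pnatr_eq0.
  have F0 : j`!%:R != 0 :> R by rewrite pnatr_eq0 -lt0n fact_gt0.
  move: (j.+1%:R : R) J0 (j`!%:R : R) F0 => a a0 b b0; field; exact/andP.
rewrite -mulr_sumr -[leRHS]mulr1; apply: ler_wpM2l => //.
exact: poisson_weight_sum_le1.
Qed.

Lemma ring_step_dual E k mu h :
  expect (ring_step E k mu) h = expect mu (step_op E k h).
Proof.
rewrite /expect /ring_step /step_op.
under eq_bigr do rewrite mulr_suml.
under [RHS]eq_bigr do rewrite mulr_sumr.
rewrite exchange_big [RHS]exchange_big /=; apply: eq_bigr => i _.
under eq_bigr do rewrite -mulrA mulr_suml mulr_sumr.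
under [RHS]eq_bigr do rewrite mulrCA !mulr_sumr.
rewrite exchange_big /=; apply: eq_bigr => x _; apply: eq_bigr => y _.
by rewrite !mulrA.
Qed.

Lemma expect_dirac x0 h : expect (fun x => (x == x0)%:R) h = h x0.
Proof.
rewrite /expect (bigD1 x0)//= eqxx mul1r big1 ?addr0// => x /negPf ->.
by rewrite mul0r.
Qed.

Lemma iter_ring_step_dual E k mu h j :
  expect (iter j (ring_step E k) mu) h = expect mu (iter j (step_op E k) h).
Proof.
elim: j h => [//|j IH] h.
by rewrite iterS ring_step_dual IH iterSr.
Qed.

Section OneChain.
Variables (E : {set I}) (k : I -> T -> T -> R).
Hypothesis k_ge0 : forall i x y, 0 <= k i x y.
Hypothesis k_sum1 : forall i x, \sum_y k i x y = 1.

Lemma step_op_mono h h' : (forall x, h x <= h' x) ->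
  forall x, step_op E k h x <= step_op E k h' x.
Proof.
move=> hh' x; apply: ler_sum => i _; apply: ler_wpM2l; first by rewrite invr_ge0.
by apply: ler_sum => y _; apply: ler_wpM2l.
Qed.

Lemma step_op_cst_le (c : R) x : 0 <= c -> step_op E k (fun=> c) x <= c.
Proof.
move=> c0; rewrite /step_op.
under eq_bigr do rewrite -mulr_suml k_sum1 mul1r.
rewrite sumr_const -[leLHS]mulr_natl mulrA.
have [->|M0] := eqVneq (#|E|%:R : R) 0; first by rewrite !mul0r.
by rewrite divff// mul1r.
Qed.

Lemma iter_ring_step_ge0 mu j y : (forall x, 0 <= mu x) ->
  0 <= iter j (ring_step E k) mu y.
Proof.
move=> mu0; elim: j y => [//|j IH] y.
apply: sumr_ge0 => i _; apply: mulr_ge0; first by rewrite invr_ge0.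
by apply: sumr_ge0 => x _; apply: mulr_ge0; [exact: IH | exact: k_ge0].
Qed.

Lemma iter_ring_step_le1 x0 j y : iter j (ring_step E k) (fun x => (x == x0)%:R) y <= 1.
Proof.
have := iter_ring_step_dual E k (fun x => (x == x0)%:R) (fun=> 1) j.
rewrite expect_dirac => H.
have H1 : iter j (step_op E k) (fun=> 1) x0 <= 1.
  elim: j x0 {H} => [//|j IH] x0.
  by rewrite iterS; apply: le_trans (step_op_cst_le x0 ler01); exact: step_op_mono.
apply: le_trans H1; rewrite -H /expect (bigD1 y)//= mulr1 lerDl.
by apply: sumr_ge0 => x _; rewrite mulr1 iter_ring_step_ge0// => z; exact: ler0n.
Qed.

Lemma clock_law_cvg x0 t y : 0 <= t ->
  (fun m => \sum_(0 <= j < m) poisson_weight (#|E|%:R * t) j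
     * iter j (ring_step E k) (fun x => (x == x0)%:R) y) @ \oo --> clock_law E k x0 t y.
Proof.
move=> t0; set r := #|E|%:R * t.
have r0 : 0 <= r by rewrite mulr_ge0.
have a0 j : 0 <= iter j (ring_step E k) (fun x => (x == x0)%:R) y.
  by apply: iter_ring_step_ge0 => x; exact: ler0n.
suff : cvgn (series (fun j => poisson_weight r j
    * iter j (ring_step E k) (fun x => (x == x0)%:R) y)) by [].
apply: (@series_le_cvg _ _ (poisson_weight r)) => [j|j|j|].
- by rewrite mulr_ge0// poisson_weight_ge0.
- exact: poisson_weight_ge0.
- by rewrite ler_piMr ?poisson_weight_ge0// iter_ring_step_le1.
- by apply/cvg_ex; exists 1; exact: poisson_weight_cvg.
Qed.

(** Conditioning on the number of rings: the mean of an observable at time [t] is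
    the Poisson average of its means after a given number of updates. *)
Lemma expect_clock_law_cvg x0 t h : 0 <= t ->
  (fun m => \sum_(0 <= j < m) poisson_weight (#|E|%:R * t) j
     * iter j (step_op E k) h x0) @ \oo --> expect (clock_law E k x0 t) h.
Proof.
move=> t0.
have -> : (fun m => \sum_(0 <= j < m) poisson_weight (#|E|%:R * t) j
     * iter j (step_op E k) h x0) =
   (fun m => \sum_y (\sum_(0 <= j < m) poisson_weight (#|E|%:R * t) j
     * iter j (ring_step E k) (fun x => (x == x0)%:R) y) * h y).
  apply/funext => m; under [RHS]eq_bigr do rewrite mulr_suml.
  rewrite exchange_big/=; apply: eq_bigr => j _.
  rewrite -expect_dirac -iter_ring_step_dual mulr_sumr.
  by apply: eq_bigr => y _; rewrite mulrA.
apply: cvg_big => [|y _]; first exact: add_continuous.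
by apply: cvgMr_tmp; exact: clock_law_cvg.
Qed.

Lemma clock_law_ge0 x0 t y : 0 <= t -> 0 <= clock_law E k x0 t y.
Proof.
move=> t0; apply: (cvgr_to_ge (clock_law_cvg (x0 := x0) (y := y) t0)).
apply: nearW => m; apply: sumr_ge0 => j _; apply: mulr_ge0.
  by apply: poisson_weight_ge0; rewrite mulr_ge0.
by apply: iter_ring_step_ge0 => x; exact: ler0n.
Qed.

Definition generator (x y : T) : R := \sum_(i in E) (k i x y - (x == y)%:R).

Lemma generatorE mu y : \sum_x mu x * generator x y =
  \sum_(i in E) (\sum_x mu x * k i x y - mu y).
Proof.
under eq_bigr do rewrite mulr_sumr.
rewrite exchange_big /=; apply: eq_bigr => i _.
under eq_bigr do rewrite mulrBr.
rewrite sumrB; congr (_ - _).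
rewrite (bigD1 y)//= eqxx mulr1 big1 ?addr0// => x /negPf ->.
by rewrite mulr0.
Qed.

Lemma generator_sum0 x : \sum_y generator x y = 0.
Proof.
rewrite /generator exchange_big/= big1// => i _.
rewrite sumrB k_sum1 (bigD1 x)//= eqxx big1 ?addr0 ?subrr// => y /negPf.
by rewrite eq_sym => ->.
Qed.

Lemma clock_law_ode x0 t y :
  is_derive t (1 : R) (fun s => clock_law E k x0 s y)
    (\sum_x clock_law E k x0 t x * generator x y).
Proof. rewrite generatorE; exact: clock_law_forward. Qed.

(** The rows of the generator add up to 0, so the total mass does not move. *)
Lemma clock_law_sum1 x0 t : \sum_y clock_law E k x0 t y = 1.
Proof.
pose F s := \sum_y clock_law E k x0 s y.
have F' s : is_derive s (1 : R) F 0.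
  have := @is_derive_fsum R T xpredT _ _ s (clock_law_ode x0 s).
  congr (is_derive _ _ _ _); rewrite exchange_big big1//= => x _.
  by rewrite -mulr_sumr generator_sum0 mulr0.
rewrite -/(F t) (is_derive_0_is_cst t 0 F') /F.
under eq_bigr do rewrite clock_law0//.
by rewrite (bigD1 x0)//= eqxx big1 ?addr0// => y /negPf ->.
Qed.

(** As functions of [t], both sides solve the forward equation started from the law
    at time [s]. *)
Lemma clock_law_semigroup x0 s t y : 0 <= t ->
  clock_law E k x0 (s + t) y = \sum_x clock_law E k x0 s x * clock_law E k x t y.
Proof.
move=> t0.
pose D t y := clock_law E k x0 (s + t) y
  - \sum_x clock_law E k x0 s x * clock_law E k x t y.
suff : D t y = 0 by move/eqP; rewrite subr_eq0 => /eqP.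
apply: (@linear_ode_zero _ _ generator) t0 => [{}t {}y|{}y].
  have D1 : is_derive t (1 : R) (fun t => clock_law E k x0 (s + t) y)
      (\sum_x clock_law E k x0 (s + t) x * generator x y).
    have Hs : is_derive t (1 : R) (fun t => s + t) 1.
      have := @is_deriveD _ _ _ (cst s) id t 1 0 1 _ _.
      by rewrite add0r; apply; exact: is_derive_cst || exact: is_derive_id.
    have := @is_derive1_comp _ (fun u => clock_law E k x0 u y) (fun t => s + t) t _ _
      (clock_law_ode x0 (s + t) y) Hs.
    by rewrite mulr1.
  have D2 : is_derive t (1 : R) (fun t => \sum_x clock_law E k x0 s x * clock_law E k x t y)
     (\sum_x clock_law E k x0 s x * \sum_z clock_law E k x t z * generator z y).
    apply: is_derive_fsum => x.
    exact: (@is_deriveZ _ _ _ (fun t => clock_law E k x t y) (clock_law E k x0 s x) t 1 _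
      (clock_law_ode x t y)).
  have := @is_deriveB _ _ _ _ _ t 1 _ _ D1 D2.
  congr (is_derive _ _ _ _).
  rewrite /D; under [RHS]eq_bigr do rewrite mulrBl mulr_suml.
  rewrite sumrB; congr (_ - _); rewrite exchange_big/=.
  by apply: eq_bigr => x _; rewrite mulr_sumr; apply: eq_bigr => z _; rewrite mulrA.
rewrite /D addr0 (bigD1 y)//= clock_law0// eqxx mulr1 big1 ?addr0 ?subrr// => x xy.
by rewrite clock_law0// eq_sym (negPf xy) mulr0.
Qed.

(** Invariance under each update makes the constant [mu] a solution of the forward
    equation, which the left-hand side solves from the same initial value. *)
Lemma clock_law_stationary mu t y : 0 <= t ->
  (forall i y, i \in E -> \sum_x mu x * k i x y = mu y) ->
  \sum_x mu x * clock_law E k x t y = mu y.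
Proof.
move=> t0 st.
pose D t y := \sum_x mu x * clock_law E k x t y - mu y.
suff : D t y = 0 by move/eqP; rewrite subr_eq0 => /eqP.
apply: (@linear_ode_zero _ _ generator) t0 => [{}t {}y|{}y].
  have D2 : is_derive t (1 : R) (fun t => \sum_x mu x * clock_law E k x t y)
     (\sum_x mu x * \sum_z clock_law E k x t z * generator z y).
    apply: is_derive_fsum => x.
    exact: (@is_deriveZ _ _ _ (fun t => clock_law E k x t y) (mu x) t 1 _
      (clock_law_ode x t y)).
  have := @is_deriveB _ _ _ _ _ t 1 _ _ D2 (is_derive_cst (mu y) t 1).
  congr (is_derive _ _ _ _).
  rewrite subr0 /D; under [RHS]eq_bigr do rewrite mulrBl mulr_suml.
  rewrite sumrB generatorE [X in _ - X]big1 ?subr0; last first.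
    by move=> i iE; rewrite st// subrr.
  rewrite exchange_big/=.
  by apply: eq_bigr => x _; rewrite mulr_sumr; apply: eq_bigr => z _; rewrite mulrA.
rewrite /D (bigD1 y)//= clock_law0// eqxx mulr1 big1 ?addr0 ?subrr// => x xy.
by rewrite clock_law0// eq_sym (negPf xy) mulr0.
Qed.

(** By the semigroup property the law at time [t] and [mu] are the images of the law
    at time [s] and [mu] under one stochastic kernel, which contracts the L1 norm. *)
Lemma tv_clock_law_nincr mu x0 s t : 0 <= s <= t ->
  (forall i y, i \in E -> \sum_x mu x * k i x y = mu y) ->
  tv (clock_law E k x0 t) mu <= tv (clock_law E k x0 s) mu.
Proof.
move=> /andP[s0 st] stat; rewrite /tv; apply: ler_wpM2l; first by rewrite invr_ge0.
have u0 : 0 <= t - s by rewrite subr_ge0.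
apply: (@le_trans _ _ (\sum_y \sum_x `|clock_law E k x0 s x - mu x| * clock_law E k x (t - s) y)).
  apply: ler_sum => y _.
  rewrite -{1}(subrKC s t) clock_law_semigroup// -{1}(clock_law_stationary y u0 stat).
  rewrite -sumrB; apply: le_trans (ler_norm_sum _ _ _) _.
  apply: ler_sum => x _; rewrite -mulrBl normrM.
  by rewrite [X in _ * X <= _]ger0_norm ?clock_law_ge0.
rewrite exchange_big/=; apply: ler_sum => x _.
by rewrite -mulr_sumr clock_law_sum1 mulr1.
Qed.

End OneChain.

(** Thinning of Poisson clocks: a clock whose ring changes nothing contributes 0 to
    the generator. *)
Lemma clock_law_thin (E E' : {set I}) k k' x0 t y : 0 <= t ->
  (forall i x y, 0 <= k i x y) -> (forall i x, \sum_y k i x y = 1) ->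
  (forall i x y, 0 <= k' i x y) -> (forall i x, \sum_y k' i x y = 1) ->
  E' \subset E -> (forall i, i \in E' -> k' i = k i) ->
  (forall i x y, i \in E -> i \notin E' -> k i x y = (x == y)%:R) ->
  clock_law E k x0 t y = clock_law E' k' x0 t y.
Proof.
move=> t0 k0 k1 k0' k1' sE kE kid.
have genE x z : generator E k x z = generator E' k' x z.
  rewrite /generator [LHS](big_setID E')/= (finset.setIidPr sE) [X in _ + X]big1 ?addr0.
    by apply: eq_bigr => i iE; rewrite kE.
  by move=> i; rewrite inE => /andP[iE' iE]; rewrite kid// subrr.
pose D t y := clock_law E k x0 t y - clock_law E' k' x0 t y.
suff : D t y = 0 by move/eqP; rewrite subr_eq0 => /eqP.
apply: (@linear_ode_zero _ _ (generator E k)) t0 => [{}t {}y|{}y].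
  have := @is_deriveB _ _ _ _ _ t 1 _ _ (clock_law_ode E k0 k1 x0 t y)
    (clock_law_ode E' k0' k1' x0 t y).
  congr (is_derive _ _ _ _); rewrite -sumrB; apply: eq_bigr => x _.
  by rewrite -genE -mulrBl.
by rewrite /D !clock_law0// subrr.
Qed.

End ClockLaw.

(** * Updates acting on observables *)

Section StepOp.
Context {R : realType} {I T : finType}.
Implicit Types (E : {set I}) (k : I -> T -> T -> R) (mu f g h : T -> R).

Lemma step_op_le E k k' h h' x x' :
  (forall i, i \in E -> expect (k i x) h <= expect (k' i x') h') ->
  step_op E k h x <= step_op E k' h' x'.
Proof.
move=> H; apply: ler_sum => i iE; apply: ler_wpM2l; first by rewrite invr_ge0.
exact: H.
Qed.

Lemma step_op_ge0 E k h x : (forall i y, 0 <= k i x y) -> (forall y, 0 <= h y) ->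
  0 <= step_op E k h x.
Proof.
move=> k0 h0; apply: sumr_ge0 => i _; apply: mulr_ge0; first by rewrite invr_ge0.
by apply: sumr_ge0 => y _; exact: mulr_ge0.
Qed.

Lemma iter_step_op_ge0 E k h j x : (forall i x y, 0 <= k i x y) -> (forall y, 0 <= h y) ->
  0 <= iter j (step_op E k) h x.
Proof.
move=> k0 h0; elim: j x => [//|j IH] x; rewrite iterS.
by apply: step_op_ge0.
Qed.

Lemma step_op_sum (J : finType) (P : pred J) E k (f : J -> T -> R) x :
  step_op E k (fun y => \sum_(e | P e) f e y) x = \sum_(e | P e) step_op E k (f e) x.
Proof.
rewrite /step_op exchange_big/=; apply: eq_bigr => i _.
rewrite -mulr_sumr exchange_big/=; congr (_ * _); apply: eq_bigr => y _.
by rewrite mulr_sumr.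
Qed.

Lemma iter_step_op_sum (J : finType) (P : pred J) E k (f : J -> T -> R) j x :
  iter j (step_op E k) (fun y => \sum_(e | P e) f e y) x =
  \sum_(e | P e) iter j (step_op E k) (f e) x.
Proof.
elim: j x => [//|j IH] x; rewrite iterS.
rewrite (_ : iter j _ _ = fun y => \sum_(e | P e) iter j (step_op E k) (f e) y); last
    exact/funext.
exact: step_op_sum.
Qed.

Lemma step_opD E k f g x :
  step_op E k (fun y => f y + g y) x = step_op E k f x + step_op E k g x.
Proof.
rewrite /step_op -big_split/=; apply: eq_bigr => i _; rewrite -mulrDr -big_split/=.
by congr (_ * _); apply: eq_bigr => y _; rewrite mulrDr.
Qed.

Lemma step_opZ E k (a : R) f x :
  step_op E k (fun y => a * f y) x = a * step_op E k f x.
Proof.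
rewrite /step_op mulr_sumr; apply: eq_bigr => i _; rewrite mulrCA; congr (_ * _).
by rewrite mulr_sumr; apply: eq_bigr => y _; rewrite mulrCA.
Qed.

Lemma iter_step_opD E k f g j x :
  iter j (step_op E k) (fun y => f y + g y) x =
  iter j (step_op E k) f x + iter j (step_op E k) g x.
Proof.
elim: j x => [//|j IH] x; rewrite !iterS -step_opD.
by congr (step_op _ _ _ _); exact/funext.
Qed.

Lemma iter_step_opZ E k (a : R) f j x :
  iter j (step_op E k) (fun y => a * f y) x = a * iter j (step_op E k) f x.
Proof.
elim: j x => [//|j IH] x; rewrite !iterS -step_opZ.
by congr (step_op _ _ _ _); exact/funext.
Qed.

Lemma iter_step_opB E k f g j x :
  iter j (step_op E k) (fun y => f y - g y) x =
  iter j (step_op E k) f x - iter j (step_op E k) g x.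
Proof.
rewrite -[X in _ - X]mul1r -mulNr -iter_step_opZ -iter_step_opD.
by congr (iter _ _ _ _); apply/funext => y; rewrite mulN1r.
Qed.

Lemma step_op_cst E k (c : R) x : E != finset.set0 -> (forall i, i \in E -> \sum_y k i x y = 1) ->
  step_op E k (fun=> c) x = c.
Proof.
move=> E0 k1; rewrite /step_op (eq_bigr (fun=> #|E|%:R^-1 * c)) => [|i iE]; last first.
  by rewrite -mulr_suml k1// mul1r.
rewrite sumr_const -[LHS]mulr_natl mulrA divff ?mul1r// pnatr_eq0 -lt0n card_gt0.
exact: E0.
Qed.

Lemma iter_step_op_cst E k (c : R) j x : E != finset.set0 -> (forall i x, \sum_y k i x y = 1) ->
  iter j (step_op E k) (fun=> c) x = c.
Proof.
move=> E0 k1; elim: j x => [//|j IH] x; rewrite iterS.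
rewrite (_ : iter j _ _ = fun=> c); last exact/funext.
exact: step_op_cst.
Qed.

Lemma expect_step_op E k mu h : E != finset.set0 ->
  (forall i h, i \in E -> \sum_x mu x * expect (k i x) h = expect mu h) ->
  expect mu (step_op E k h) = expect mu h.
Proof.
move=> E0 st; rewrite /expect/step_op; under eq_bigr do rewrite mulr_sumr.
rewrite exchange_big/= (eq_bigr (fun=> #|E|%:R^-1 * expect mu h)) => [|i iE]; last first.
  by rewrite -(st i h iE) mulr_sumr; apply: eq_bigr => x _; rewrite mulrCA.
rewrite sumr_const -[LHS]mulr_natl mulrA divff ?mul1r// pnatr_eq0 -lt0n card_gt0.
exact: E0.
Qed.

Lemma expect_iter_step_op E k mu h j : E != finset.set0 ->
  (forall i h, i \in E -> \sum_x mu x * expect (k i x) h = expect mu h) ->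
  expect mu (iter j (step_op E k) h) = expect mu h.
Proof.
by move=> E0 st; elim: j => [//|j IH]; rewrite iterS expect_step_op.
Qed.

Lemma expectB mu f g : expect mu (fun x => f x - g x) = expect mu f - expect mu g.
Proof. by rewrite /expect -sumrB; apply: eq_bigr => x _; rewrite mulrBr. Qed.

Lemma expectD mu f g : expect mu (fun x => f x + g x) = expect mu f + expect mu g.
Proof. by rewrite /expect -big_split; apply: eq_bigr => x _; rewrite mulrDr. Qed.

Lemma expect_sum (J : finType) (P : pred J) mu (f : J -> T -> R) :
  expect mu (fun y => \sum_(e | P e) f e y) = \sum_(e | P e) expect mu (f e).
Proof.
rewrite /expect exchange_big/=; apply: eq_bigr => x _; exact: mulr_sumr.
Qed.

Lemma expect_cst mu (c : R) : \sum_x mu x = 1 -> expect mu (fun=> c) = c.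
Proof. by move=> m1; rewrite /expect -mulr_suml m1 mul1r. Qed.

Lemma ler_expect mu f g : (forall x, 0 <= mu x) -> (forall x, mu x != 0 -> f x <= g x) ->
  expect mu f <= expect mu g.
Proof.
move=> m0 fg; apply: ler_sum => x _; have [->|mx] := eqVneq (mu x) 0; first by rewrite !mul0r.
by apply: ler_wpM2l => //; exact: fg.
Qed.

End StepOp.

(** * Attractive single-edge dynamics *)

Section EdgeDynamics.
Context {R : realType} {I : finType}.
Implicit Types (iota : phase) (E : {set I}) (w : {set I}) (h : {set I} -> R)
  (alpha : {set I} -> I -> R) (S : {set {set I}}).

(** The extremal configuration of the phase is the largest one in this order, so that
    the wired and the free phase are treated together. *)
Definition phase_le iota w w' : bool :=
  match iota with Wired => w \subset w' | Free => w' \subset w end.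

Definition phase_ler iota (a b : R) : bool :=
  match iota with Wired => a <= b | Free => b <= a end.

Definition phase_top iota E : {set I} := match iota with Wired => E | Free => finset.set0 end.
Definition phase_bot iota E : {set I} := match iota with Wired => finset.set0 | Free => E end.

Definition agree iota (e : I) w : R :=
  match iota with Wired => (e \in w)%:R | Free => (e \notin w)%:R end.

Definition mono_on iota E h : Prop :=
  forall w w', w \subset E -> w' \subset E -> phase_le iota w w' -> h w <= h w'.

(** The kernel [fk_update] with an arbitrary rule [alpha w i] for the probability of
    opening the edge [i] in [w]. *)
Definition heat_bath alpha S (i : I) w w' : R :=
  let accept w1 := if w1 \in S then w1 else w in
  alpha w i * (w' == accept (i |: w))%:R + (1 - alpha w i) * (w' == accept (w :\ i))%:R.

(** The sub-Markov kernel of the dynamics stopped at its first attempt to leave [S]: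
    where [heat_bath] rejects a move, the mass is lost. *)
Definition killed alpha S (i : I) w w' : R :=
  if (w \in S) && (w' \in S) then heat_bath alpha [set: {set I}] i w w' else 0.

(** Clocks outside [E] ring without effect; dynamics in different domains can thus
    share one set of clocks and be compared ring by ring. *)
Definition idle_outside E (k : I -> {set I} -> {set I} -> R) (i : I) w w' : R :=
  if i \in E then k i w w' else (w == w')%:R.

Definition attractive E alpha : Prop :=
  (forall w i, 0 <= alpha w i <= 1) /\
  (forall w w' i, i \in E -> w \subset w' -> alpha w i <= alpha w' i).

Lemma heat_bath_ge0 alpha S i w w' : (forall w i, 0 <= alpha w i <= 1) ->
  0 <= heat_bath alpha S i w w'.
Proof.
by move=> /(_ w i)/andP[a0 a1]; rewrite addr_ge0// mulr_ge0// subr_ge0.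
Qed.

Lemma sum_indicator (w0 : {set I}) h : \sum_w (w == w0)%:R * h w = h w0.
Proof. exact: expect_dirac. Qed.

Lemma expect_heat_bath alpha S i w h :
  let accept w1 := if w1 \in S then w1 else w in
  expect (heat_bath alpha S i w) h =
  alpha w i * h (accept (i |: w)) + (1 - alpha w i) * h (accept (w :\ i)).
Proof.
rewrite /expect /heat_bath; under eq_bigr do rewrite mulrDl -!mulrA.
by rewrite big_split/= -!mulr_sumr !sum_indicator.
Qed.

Lemma expect_heat_bathT alpha i w h : expect (heat_bath alpha [set: {set I}] i w) h =
  alpha w i * h (i |: w) + (1 - alpha w i) * h (w :\ i).
Proof. by rewrite expect_heat_bath !inE. Qed.

Lemma heat_bath_sum1 alpha S i w : \sum_w' heat_bath alpha S i w w' = 1.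
Proof.
have := expect_heat_bath alpha S i w (fun=> 1).
by rewrite /expect -mulr_suml mulr1 => ->; ring.
Qed.

Lemma killed_ge0 alpha S i w w' : (forall w i, 0 <= alpha w i <= 1) ->
  0 <= killed alpha S i w w'.
Proof. by move=> a01; rewrite /killed; case: ifP => // _; exact: heat_bath_ge0. Qed.

Lemma expect_killed alpha S i w h : expect (killed alpha S i w) h =
  if w \in S then alpha w i * ((i |: w \in S)%:R * h (i |: w)) +
                  (1 - alpha w i) * ((w :\ i \in S)%:R * h (w :\ i)) else 0.
Proof.
case: ifP => wS; last first.
  by rewrite /expect big1// => y _; rewrite /killed wS mul0r.
rewrite -(expect_heat_bathT alpha i w (fun w => (w \in S)%:R * h w)).
apply: eq_bigr => y _; rewrite /killed wS/=.
by case: (y \in S); rewrite ?mul1r ?mul0r ?mulr0.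
Qed.

Lemma idle_ge0 E k i w w' : (forall i w w', 0 <= k i w w') -> 0 <= idle_outside E k i w w'.
Proof. by move=> k0; rewrite /idle_outside; case: ifP. Qed.

Lemma expect_idle E k i w h :
  expect (idle_outside E k i w) h = if i \in E then expect (k i w) h else h w.
Proof.
rewrite /idle_outside; case: ifP => // _; rewrite -[RHS]sum_indicator.
by apply: eq_bigr => y _; rewrite eq_sym.
Qed.

Lemma idle_sum1 E k i w : (forall i w, \sum_w' k i w w' = 1) -> \sum_w' idle_outside E k i w w'
    = 1.
Proof.
move=> k1; have := expect_idle E k i w (fun=> 1).
by rewrite /expect -!mulr_suml !mulr1 k1 => ->; case: ifP.
Qed.

Lemma phase_le_top iota E w : w \subset E -> phase_le iota w (phase_top iota E).
Proof. by case: iota => //= _; rewrite finset.sub0set. Qed.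

Lemma phase_bot_le iota E w : w \subset E -> phase_le iota (phase_bot iota E) w.
Proof. by case: iota => //= _; rewrite finset.sub0set. Qed.

Lemma phase_top_sub iota E : phase_top iota E \subset E.
Proof. by case: iota; rewrite //= finset.sub0set. Qed.

Lemma phase_bot_sub iota E : phase_bot iota E \subset E.
Proof. by case: iota; rewrite //= finset.sub0set. Qed.

Lemma phase_top_setI iota E E' : E' \subset E -> phase_top iota E :&: E' = phase_top iota E'.
Proof. by case: iota => /= sE; rewrite ?finset.set0I// (finset.setIidPr sE). Qed.

Lemma agree_ge0 iota e w : 0 <= agree iota e w.
Proof. by case: iota => /=. Qed.

Lemma agree_mono iota E e : mono_on iota E (agree iota e).
Proof.
case: iota => w w' _ _ /= /fintype.subsetP/(_ e) sw; rewrite ler_nat.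
  by case: (e \in w') sw => [->|] //; case: (e \notin w).
by case: (e \in w) sw => [->|].
Qed.

Lemma setU1_sub E w i : i \in E -> w \subset E -> i |: w \subset E.
Proof. by move=> iE wE; rewrite finset.subUset finset.sub1set iE. Qed.

Lemma setD1_sub E w i : w \subset E -> w :\ i \subset E.
Proof. by move=> wE; apply: fintype.subset_trans wE; exact: finset.subD1set. Qed.

Lemma phase_le_add iota w w' i : phase_le iota w w' -> phase_le iota (i |: w) (i |: w').
Proof. by case: iota => /= ?; exact: finset.setUS. Qed.

Lemma phase_le_del iota w w' i : phase_le iota w w' -> phase_le iota (w :\ i) (w' :\ i).
Proof. by case: iota => /= ?; exact: finset.setSD. Qed.

(** For a monotone observable one of the two outcomes of the update is the better one,
    and the second rule puts more weight on it. *)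
Lemma heat_bath_weight_le iota E h i w (a a' : R) : mono_on iota E h -> i \in E ->
  w \subset E -> phase_ler iota a a' ->
  a * h (i |: w) + (1 - a) * h (w :\ i) <= a' * h (i |: w) + (1 - a') * h (w :\ i).
Proof.
move=> mh iE wE; have ws : w :\ i \subset i |: w.
  by apply: fintype.subset_trans (finset.subD1set _ _) (finset.subsetUr _ _).
have h1 := mh _ _ (setD1_sub i wE) (setU1_sub iE wE).
have h2 := mh _ _ (setU1_sub iE wE) (setD1_sub i wE).
case: iota mh h1 h2 => /= mh h1 h2 aa'.
  have {h1 h2} := h2 ws; nra.
have {h1 h2} := h1 ws; nra.
Qed.

Lemma attractive_phase iota E alpha w w' i : attractive E alpha -> i \in E ->
  phase_le iota w w' -> phase_ler iota (alpha w i) (alpha w' i).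
Proof. by move=> [_ at_]; case: iota => /= iE ww'; exact: at_. Qed.

Lemma heat_bath_mono iota E alpha h i : attractive E alpha -> i \in E ->
  mono_on iota E h -> mono_on iota E (fun w => expect (heat_bath alpha [set: {set I}] i w) h).
Proof.
move=> at_ iE mh w w' wE w'E ww'; rewrite !expect_heat_bathT.
apply: le_trans (heat_bath_weight_le mh iE wE (attractive_phase at_ iE ww')) _.
have [a01 _] := at_; have /andP[a0 a1] := a01 w' i.
apply: lerD; apply: ler_wpM2l; rewrite ?subr_ge0//; apply: mh.
- exact: setU1_sub.
- exact: setU1_sub.
- exact: phase_le_add.
- exact: setD1_sub.
- exact: setD1_sub.
- exact: phase_le_del.
Qed.

Lemma idle_mono iota E E' alpha h i : attractive E' alpha -> E' \subset E ->
  mono_on iota E' h ->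
  mono_on iota E' (fun w => expect (idle_outside E' (heat_bath alpha [set: {set I}]) i w) h).
Proof.
move=> at_ sE mh w w' wE w'E ww'; rewrite !expect_idle; case: ifP => iE; last exact: mh.
exact: (heat_bath_mono at_ iE mh).
Qed.

Lemma iter_idle_mono iota E E' alpha h j : attractive E' alpha -> E' \subset E ->
  mono_on iota E' h ->
  mono_on iota E' (iter j (step_op E (idle_outside E' (heat_bath alpha [set: {set I}]))) h).
Proof.
move=> at_ sE mh; elim: j => [//|j IH] w w' wE w'E ww'; rewrite iterS.
by apply: step_op_le => i _; exact: (idle_mono i at_ sE IH).
Qed.

(** Updates outside [E2] do not change the observable; at an edge of [E2] the rule
    [alpha2] gives more weight to the outcome that agrees with the phase. *)
Lemma idle_compare iota E E1 E2 alpha1 alpha2 h i w :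
  attractive E1 alpha1 -> E2 \subset E1 -> E1 \subset E ->
  (forall w i, i \in E2 -> w \subset E1 ->
     phase_ler iota (alpha1 w i) (alpha2 (w :&: E2) i)) ->
  mono_on iota E2 h -> w \subset E1 ->
  expect (idle_outside E1 (heat_bath alpha1 [set: {set I}]) i w) (fun w => h (w :&: E2)) <=
  expect (idle_outside E2 (heat_bath alpha2 [set: {set I}]) i (w :&: E2)) h.
Proof.
move=> at_ s21 s1 cmp mh wE1; rewrite !expect_idle.
have [i2|i2] := boolP (i \in E2); last first.
  case: ifP => // _; rewrite expect_heat_bathT.
  have -> : (i |: w) :&: E2 = w :&: E2.
    apply/finset.setP => x; rewrite !inE; case: eqP => // ->.
    by rewrite (negPf i2) !andbF.
  have -> : (w :\ i) :&: E2 = w :&: E2.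
    apply/finset.setP => x; rewrite !inE; case: eqP => // ->.
    by rewrite (negPf i2) !andbF.
  by rewrite le_eqVlt; apply/orP; left; apply/eqP; ring.
rewrite (fintype.subsetP s21 _ i2) !expect_heat_bathT.
have -> : (i |: w) :&: E2 = i |: (w :&: E2).
  by apply/finset.setP => x; rewrite !inE; case: eqP => // ->; rewrite i2.
have -> : (w :\ i) :&: E2 = (w :&: E2) :\ i by rewrite finset.setIDAC.
apply: heat_bath_weight_le mh i2 _ (cmp _ _ i2 wE1); exact: finset.subsetIr.
Qed.

Lemma idle_le E E1 alpha i w f g : (forall w i, 0 <= alpha w i <= 1) -> E1 \subset E ->
  (forall w, w \subset E1 -> f w <= g w) -> w \subset E1 ->
  expect (idle_outside E1 (heat_bath alpha [set: {set I}]) i w) f <=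
  expect (idle_outside E1 (heat_bath alpha [set: {set I}]) i w) g.
Proof.
move=> a01 s1 fg wE; rewrite !expect_idle; case: ifP => iE; last exact: fg.
rewrite !expect_heat_bathT; have /andP[a0 a1] := a01 w i.
apply: lerD; apply: ler_wpM2l; rewrite ?subr_ge0//; apply: fg.
- exact: setU1_sub.
- exact: setD1_sub.
Qed.

Lemma iter_idle_le E E1 alpha f g j w : (forall w i, 0 <= alpha w i <= 1) -> E1 \subset E ->
  (forall w, w \subset E1 -> f w <= g w) -> w \subset E1 ->
  iter j (step_op E (idle_outside E1 (heat_bath alpha [set: {set I}]))) f w <=
  iter j (step_op E (idle_outside E1 (heat_bath alpha [set: {set I}]))) g w.
Proof.
move=> a01 s1 fg; elim: j w => [//|j IH] w wE.
by rewrite !iterS; apply: step_op_le => i _; exact: (@idle_le E).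
Qed.

Lemma iter_idle_compare iota E E1 E2 alpha1 alpha2 h j w :
  attractive E1 alpha1 -> attractive E2 alpha2 -> E2 \subset E1 -> E1 \subset E ->
  (forall w i, i \in E2 -> w \subset E1 ->
     phase_ler iota (alpha1 w i) (alpha2 (w :&: E2) i)) ->
  mono_on iota E2 h -> w \subset E1 ->
  iter j (step_op E (idle_outside E1 (heat_bath alpha1 [set: {set I}]))) (fun w => h (w :&:
      E2)) w <=
  iter j (step_op E (idle_outside E2 (heat_bath alpha2 [set: {set I}]))) h (w :&: E2).
Proof.
move=> at1 at2 s21 s1 cmp mh; elim: j w => [//|j IH] w wE1.
rewrite !iterS; apply: step_op_le => i _.
apply: le_trans (idle_compare i at1 s21 s1 cmp _ wE1).
  by apply: (@idle_le E) wE1 => //; case: at1.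
apply: iter_idle_mono => //; exact: fintype.subset_trans s21 s1.
Qed.

End EdgeDynamics.

(** * Exit from a phase *)

Section ExitEstimate.
Context {R : realType} {I : finType}.
Implicit Types (w v : {set I}) (h : {set I} -> R).
Variables (iota : phase) (E : {set I}) (alpha : {set I} -> I -> R) (S : {set {set I}}).
Variable nu : {set I} -> R.
Hypothesis alpha_att : attractive E alpha.
Hypothesis E_neq0 : E != finset.set0.
Hypothesis S_sub : forall w, w \in S -> w \subset E.
Hypothesis S_up : forall w w', w \in S -> w' \subset E -> phase_le iota w w' -> w' \in S.
Hypothesis S_top : phase_top iota E \in S.
Hypothesis nu_ge0 : forall w, 0 <= nu w.
Hypothesis nu_sum1 : \sum_w nu w = 1.
Hypothesis nu_supp : forall w, w \notin S -> nu w = 0.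
Hypothesis nu_stat : forall i h, i \in E ->
  \sum_w nu w * expect (heat_bath alpha S i w) h = expect nu h.

Local Notation K := (step_op E (heat_bath alpha S)).
Local Notation Q := (step_op E (killed alpha S)).

Definition escaping : {set {set I}} :=
  [set w in S | [exists i in E, (if i \in w then w :\ i else i |: w) \notin S]].

Let a01 w i : 0 <= alpha w i <= 1. Proof. by case: alpha_att => ? _. Qed.

Let Kge0 i w w' : 0 <= heat_bath alpha S i w w'. Proof. exact: heat_bath_ge0. Qed.
Let Qge0 i w w' : 0 <= killed alpha S i w w'. Proof. exact: killed_ge0. Qed.

Lemma killed_le_rejected f g i w : (forall w, 0 <= g w) ->
  (forall w, w \in S -> f w <= g w) -> w \in S ->
  expect (killed alpha S i w) f <= expect (heat_bath alpha S i w) g.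
Proof.
move=> g0 fg wS; rewrite expect_killed wS expect_heat_bath.
have /andP[a0 a1] := a01 w i.
apply: lerD; apply: ler_wpM2l; rewrite ?subr_ge0//.
  by case: ifP => iS; rewrite ?mul1r ?mul0r ?fg.
by case: ifP => iS; rewrite ?mul1r ?mul0r ?fg.
Qed.

Lemma iter_killed_le_rejected h j w : (forall w, 0 <= h w) -> w \in S ->
  iter j Q h w <= iter j K h w.
Proof.
move=> h0; elim: j w => [//|j IH] w wS; rewrite !iterS.
apply: step_op_le => i _; apply: killed_le_rejected => // w'.
exact: iter_step_op_ge0.
Qed.

(** Apply the domination of the killed chain by the rejecting chain to [1 - h]. *)
Lemma iter_rejected_le_killed h j w : (forall w, 0 <= h w <= 1) -> w \in S ->
  iter j K h w <= iter j Q h w + (1 - iter j Q (fun=> 1) w).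
Proof.
move=> h01 wS.
have h0 w' : 0 <= 1 - h w' by rewrite subr_ge0; case/andP: (h01 w').
have := iter_killed_le_rejected j h0 wS.
rewrite !(@iter_step_opB _ _ _ _ _ (fun=> 1) h) (@iter_step_op_cst _ _ _ E (heat_bath alpha
    S))//; first lra.
by move=> i x; exact: heat_bath_sum1.
Qed.

(** Away from [escaping] both outcomes of every update stay in [S]. *)
Lemma killed_mass_loss w : w \in S -> 1 - Q (fun=> 1) w <= (w \in escaping)%:R.
Proof.
move=> wS.
have K1 : K (fun=> 1) w = 1 by apply: step_op_cst => // i _; exact: heat_bath_sum1.
have [we|we] := boolP (w \in escaping).
  by rewrite lerBlDl lerDr step_op_ge0// => y; rewrite ?ler01.
rewrite subr_le0 -{1}K1; apply: step_op_le => i iE.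
have stay : (i |: w \in S) && (w :\ i \in S).
  move: we; rewrite inE wS/= negb_exists => /forallP/(_ i); rewrite iE/= negbK.
  case: ifP => iw => [wi|wi]; rewrite wi ?andbT/=.
    suff -> : i |: w = w by [].
    by apply/finset.setUidPr; rewrite finset.sub1set.
  suff -> : w :\ i = w by [].
  by apply/finset.setDidPl; rewrite disjoint_sym disjoints1 iw.
case/andP: stay => s1 s2.
by rewrite expect_killed expect_heat_bath wS s1 s2 !mul1r.
Qed.

Lemma killed_mass_le1 j w : iter j Q (fun=> 1) w <= 1.
Proof.
have [wS|wS] := boolP (w \in S).
  rewrite -[leRHS](@iter_step_op_cst _ _ _ E (heat_bath alpha S) 1 j w)//.
    by apply: iter_killed_le_rejected => // ? ; exact: ler01.
  by move=> i x; exact: heat_bath_sum1.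
case: j => [//|j]; rewrite iterS {1}/step_op big1 ?ler01// => i _.
by rewrite -/(expect _ _) expect_killed (negPf wS) mulr0.
Qed.

(** Each update costs at most the stationary weight of [escaping], because the
    rejecting chain, which dominates what survives, keeps [nu] invariant. *)
Lemma stationary_exit j : 
  expect nu (fun w => 1 - iter j Q (fun=> 1) w) <= j%:R * prob nu escaping.
Proof.
elim: j => [|j IH].
  by rewrite mul0r /expect big1// => w _; rewrite subrr mulr0.
pose u w := 1 - iter j Q (fun=> 1) w.
have u0 w : 0 <= u w by rewrite subr_ge0 killed_mass_le1.
apply: (@le_trans _ _ (expect nu (fun w => (w \in escaping)%:R + K u w))).
  apply: ler_expect => // w nuw.
  have wS : w \in S by apply: contraNT nuw => /nu_supp ->.
  rewrite iterS.
  have -> : iter j Q (fun=> 1) = fun w => 1 - u w.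
    by apply/funext => w'; rewrite /u subKr.
  have -> : Q (fun w => 1 - u w) w = Q (fun=> 1) w - Q u w.
    exact: (@iter_step_opB _ _ _ _ _ (fun=> 1) u 1).
  have := killed_mass_loss wS.
  have : Q u w <= K u w by apply: step_op_le => i _; exact: killed_le_rejected.
  lra.
rewrite expectD expect_step_op// -addn1 natrD mulrDl mul1r addrC lerD//.
rewrite le_eqVlt; apply/orP; left; apply/eqP.
rewrite /prob [RHS]big_mkcond/=; apply: eq_bigr => w _.
by case: (w \in escaping); rewrite ?mulr1 ?mulr0.
Qed.

(** [S] is closed under growth in the order of the phase, so cutting a nonnegative
    monotone observable to 0 outside [S] keeps it monotone. *)
Lemma killed_mono h : (forall w, 0 <= h w) -> mono_on iota E h ->
  mono_on iota E (Q h).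
Proof.
move=> h0 mh w w' wE w'E ww'; apply: step_op_le => i iE.
have [wS|wS] := boolP (w \in S); last first.
  rewrite [leLHS]expect_killed (negPf wS); apply: sumr_ge0 => y _.
  by rewrite mulr_ge0.
have w'S : w' \in S by exact: S_up ww'.
rewrite !expect_killed wS w'S.
have mh' : mono_on iota E (fun w => (w \in S)%:R * h w).
  move=> v v' vE v'E vv'; have [vS|vS] := boolP (v \in S); last by rewrite mul0r mulr_ge0.
  by rewrite (S_up vS v'E vv') !mul1r; exact: mh.
have := heat_bath_mono alpha_att iE mh' wE w'E ww'.
by rewrite !expect_heat_bathT.
Qed.

Lemma iter_killed_mono h j : (forall w, 0 <= h w) -> mono_on iota E h ->
  mono_on iota E (iter j Q h).
Proof.
move=> h0 mh; elim: j => [//|j IH]; rewrite iterS.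
by apply: killed_mono => // w; exact: iter_step_op_ge0.
Qed.

Lemma expect_le_top h : mono_on iota E h -> expect nu h <= h (phase_top iota E).
Proof.
move=> mh; rewrite -(expect_cst (h (phase_top iota E)) nu_sum1).
apply: ler_expect => // w nuw.
have wS : w \in S by apply: contraNT nuw => /nu_supp ->.
by apply: mh; rewrite ?phase_top_sub ?phase_le_top ?S_sub.
Qed.

(** A strictly larger configuration has at least one more agreeing edge, and this
    outweighs any change of an observable with values in the unit interval. This
    replaces a monotone coupling: it turns domination of one law by another into a
    bound on their total variation by the sum of the one-edge discrepancies. *)
Lemma count_minus_mono h : (forall w, 0 <= h w <= 1) ->
  mono_on iota E (fun w => \sum_(e in E) agree iota e w + (1 - h w)).
Proof.
move=> h01 w w' wE w'E ww'.
have [->//|neq] := eqVneq w w'.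
have [e eE ew] : exists2 e, e \in E & agree iota e w + 1 <= agree iota e w' :> R.
  case: iota ww' => /= ww'.
    have /fintype.properP[_ [e e1 e2]] : w' \proper w by rewrite finset.properEneq eq_sym neq.
    by exists e; [exact: (fintype.subsetP wE)|rewrite e1 e2 add0r].
  have /fintype.properP[_ [e e1 e2]] : w \proper w' by rewrite finset.properEneq neq.
  by exists e; [exact: (fintype.subsetP w'E)|rewrite e1 (negPf e2) add0r].
rewrite (bigD1 e)//= [X in _ <= X + _](bigD1 e)//=.
have : \sum_(i in E | i != e) agree iota i w <= \sum_(i in E | i != e) agree iota i w' :> R.
  by apply: ler_sum => i _; exact: (@agree_mono R I iota E i w w').
have /andP[h1 h2] := h01 w; have /andP[h3 h4] := h01 w'.
lra.
Qed.

(** The killed chain [Q] preserves monotone observables, so their means from the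
    extremal state are at least those from [nu]. Applied to the number of agreeing
    edges minus [h], which is monotone too, this bounds the mean of [h] from above by
    the discrepancies of the single edges. Replacing the rejecting chain [K] by [Q] at
    the extremal state, or a stationary mean by a mean of [Q] under [nu], costs at most
    the stationary exit probability [d]; this happens once per edge and twice more. *)
Theorem exit_estimate h j : (forall w, 0 <= h w <= 1) ->
  iter j K h (phase_top iota E) <= expect nu h +
    \sum_(e in E) (iter j Q (agree iota e) (phase_top iota E) - expect nu (agree iota e)) +
    (#|E|%:R + 2) * (j%:R * prob nu escaping).
Proof.
move=> h01; set T := phase_top iota E; set d := j%:R * _.
have h0 w : 0 <= h w by case/andP: (h01 w).
have hC0 w : 0 <= 1 - h w by rewrite subr_ge0; case/andP: (h01 w).
have mass : expect nu (iter j Q (fun=> 1)) >= 1 - d.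
  have := stationary_exit j; rewrite expectB expect_cst// -/d; lra.
have mtop : iter j Q (fun=> 1) T >= 1 - d.
  apply: le_trans mass _; apply: expect_le_top; apply: iter_killed_mono => *; rewrite ?ler01
      ?lexx//.
have Knu f : expect nu (iter j K f) = expect nu f by apply: expect_iter_step_op => // i ?
    /nu_stat ->.
have agree_loss e : expect nu (iter j Q (agree iota e)) >= expect nu (agree iota e) - d.
  have : expect nu (iter j K (agree iota e)) <=
      expect nu (fun w => iter j Q (agree iota e) w + (1 - iter j Q (fun=> 1) w)).
    apply: ler_expect => // w nuw; apply: iter_rejected_le_killed.
      by move=> v; rewrite agree_ge0/=; case: iota => /=; case: (e \in v).
    by apply: contraNT nuw => /nu_supp ->.
  rewrite Knu expectD; have := stationary_exit j; rewrite -/d; lra.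
have hQ : expect nu (iter j Q h) <= expect nu h.
  rewrite -[leRHS]Knu; apply: ler_expect => // w nuw; apply: iter_killed_le_rejected => //.
  by apply: contraNT nuw => /nu_supp ->.
have cmp : expect nu (iter j Q (fun w => \sum_(e in E) agree iota e w + (1 - h w))) <=
    iter j Q (fun w => \sum_(e in E) agree iota e w + (1 - h w)) T.
  apply: expect_le_top; apply: iter_killed_mono; last exact: count_minus_mono.
  by move=> w; rewrite addr_ge0// sumr_ge0// => e _; exact: agree_ge0.
have decomp : iter j Q (fun w => \sum_(e in E) agree iota e w + (1 - h w)) =
    fun w => \sum_(e in E) iter j Q (agree iota e) w + (iter j Q (fun=> 1) w - iter j Q h w).
  apply/funext => w; rewrite iter_step_opD iter_step_op_sum.
  by rewrite (@iter_step_opB _ _ _ _ _ (fun=> 1) h).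
move: cmp; rewrite decomp expectD expectB expect_sum => cmp.
have sumloss : \sum_(e in E) expect nu (iter j Q (agree iota e)) >=
    \sum_(e in E) expect nu (agree iota e) - #|E|%:R * d.
  rewrite (_ : #|E|%:R * d = \sum_(e in E) d); last by rewrite sumr_const mulr_natl.
  by rewrite -sumrB; apply: ler_sum => e _; exact: agree_loss.
have topK := iter_rejected_le_killed j h01 S_top.
have m1 := killed_mass_le1 j T.
rewrite sumrB mulrDl mulr2n mulrDl mul1r; rewrite -/T in topK; lra.
Qed.

End ExitEstimate.

Lemma iter_killed_le_free {R : realType} {I : finType} (E : {set I})
    (alpha : {set I} -> I -> R) (S : {set {set I}}) (h : {set I} -> R) j w :
  (forall w i, 0 <= alpha w i <= 1) -> (forall w, 0 <= h w) ->
  iter j (step_op E (killed alpha S)) h w <=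
  iter j (step_op E (idle_outside E (heat_bath alpha [set: {set I}]))) h w.
Proof.
move=> a01 h0; elim: j w => [//|j IH] w; rewrite !iterS.
apply: step_op_le => i iE; rewrite expect_idle iE.
have k0 : forall i x y, 0 <= killed alpha S i x y by move=> *; exact: killed_ge0.
rewrite expect_killed expect_heat_bathT; have /andP[a0 a1] := a01 w i.
set f := iter j _ h; set g := iter j _ h.
have f0 v : 0 <= f v by exact: iter_step_op_ge0.
have g0 v : 0 <= g v by apply: le_trans (IH v).
case: ifP => _; last by rewrite addr_ge0// mulr_ge0// subr_ge0.
apply: lerD; apply: ler_wpM2l; rewrite ?subr_ge0//.
  by case: (_ \in S); rewrite ?mul1r ?mul0r ?g0 ?IH.
by case: (_ \in S); rewrite ?mul1r ?mul0r ?g0 ?IH.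
Qed.

(** * Domination of stationary laws *)

Section Holley.
Local Open Scope classical_set_scope.
Local Open Scope ring_scope.
Context {R : realType} {I : finType}.
Implicit Types (w v : {set I}) (h : {set I} -> R).
Variables (iota : phase) (E1 E2 : {set I}) (alpha1 alpha2 : {set I} -> I -> R).
Variables (nu1 nu2 : {set I} -> R).
Hypothesis E1_neq0 : E1 != finset.set0.
Hypothesis sub21 : E2 \subset E1.
Hypothesis att1 : attractive E1 alpha1.
Hypothesis att2 : attractive E2 alpha2.
Hypothesis alpha2_in : forall w i, 0 < alpha2 w i < 1.
Hypothesis cmp : forall w i, i \in E2 -> w \subset E1 ->
     phase_ler iota (alpha1 w i) (alpha2 (w :&: E2) i).
Hypothesis nu1_ge0 : forall w, 0 <= nu1 w.
Hypothesis nu2_ge0 : forall w, 0 <= nu2 w.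
Hypothesis nu1_sum1 : \sum_w nu1 w = 1.
Hypothesis nu2_sum1 : \sum_w nu2 w = 1.
Hypothesis nu1_supp : forall w, ~~ (w \subset E1) -> nu1 w = 0.
Hypothesis nu2_supp : forall w, ~~ (w \subset E2) -> nu2 w = 0.
Hypothesis nu1_stat : forall i h, i \in E1 ->
  \sum_w nu1 w * expect (heat_bath alpha1 [set: {set I}] i w) h = expect nu1 h.
Hypothesis nu2_stat : forall i h, i \in E2 ->
  \sum_w nu2 w * expect (heat_bath alpha2 [set: {set I}] i w) h = expect nu2 h.

Local Notation K1 := (step_op E1 (idle_outside E1 (heat_bath alpha1 [set: {set I}]))).
Local Notation K2 := (step_op E1 (idle_outside E2 (heat_bath alpha2 [set: {set I}]))).
Local Notation T := (phase_top iota E2).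
Local Notation B := (phase_bot iota E2).

Let k2ge0 i x y : 0 <= idle_outside E2 (heat_bath alpha2 [set: {set I}]) i x y.
Proof. by apply: idle_ge0 => *; apply: heat_bath_ge0; case: att2. Qed.

Let disagreement w := match iota with Wired => E2 :\: w | Free => w end.

(** The extremal state is reached by fixing the disagreeing edges one at a time. *)
Lemma hit_top k w : w \subset E2 -> #|disagreement w| = k ->
  0 < iter k K2 (fun w => (w == T)%:R) w.
Proof.
elim: k w => [|k IH] w wE.
  move=> /eqP; rewrite cards_eq0 => /eqP D0 /=; suff -> : w == T by rewrite ltr01.
  move: D0; rewrite /disagreement; case: iota => /= [->//|/eqP].
  by rewrite finset.setD_eq0 finset.eqEsubset wE.
move=> Dk; have /card_gt0P[e eD] : (0 < #|disagreement w|)%N by rewrite Dk.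
rewrite iterS; set f := iter k _ _ in IH *.
have f0 v : 0 <= f v by apply: iter_step_op_ge0 => // u; exact: ler0n.
have eE2 : e \in E2.
  move: eD; rewrite /disagreement; case: iota => [/(fintype.subsetP wE)//|].
  by rewrite inE => /andP[].
have eE1 := fintype.subsetP sub21 _ eE2.
rewrite /step_op (bigD1 e)//=; apply: ltr_wpDr.
  apply: sumr_ge0 => i _; apply: mulr_ge0; first by rewrite invr_ge0.
  by apply: sumr_ge0 => y _; exact: mulr_ge0.
apply: mulr_gt0.
  by rewrite invr_gt0 ltr0n card_gt0; apply/finset.set0Pn; exists e.
rewrite -/(expect _ _) expect_idle eE2 expect_heat_bathT.
have /andP[a0 a1] := alpha2_in w e.
have b0 : 0 < 1 - alpha2 w e by rewrite subr_gt0.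
rewrite /disagreement in IH Dk eD; case: iota f IH f0 Dk eD => f IH f0 Dk eD.
  apply: ltr_wpDl; first by rewrite mulr_ge0// ltW.
  apply: mulr_gt0 => //; apply: IH; first exact: setD1_sub.
  by move: Dk; rewrite (cardsD1 e) eD => -[].
apply: ltr_wpDr; first by rewrite mulr_ge0// ltW.
apply: mulr_gt0 => //; apply: IH; first exact: setU1_sub.
move: Dk; rewrite (cardsD1 e) eD => -[<-]; congr #|pred_of_set _|.
by apply/finset.setP => x; rewrite !inE negb_or andbA.
Qed.

Let N := #|disagreement B|.
Let c := iter N K2 (fun w => (w == T)%:R) B.

Let c_gt0 : 0 < c. Proof. by apply: hit_top => //; exact: phase_bot_sub. Qed.

Let K2cst (a : R) j x : iter j K2 (fun=> a) x = a.
Proof. by apply: iter_step_op_cst => // i y; apply: idle_sum1 => *; exact: heat_bath_sum1. Qed.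

Let c_le1 : c <= 1.
Proof.
rewrite /c -[leRHS](K2cst 1 N B); apply: iter_idle_le (phase_bot_sub _ _) => //; first by case:
    att2.
by move=> w _; case: (w == T).
Qed.

(** From the worst state the chain reaches the best one within [N] updates with
    probability [c], and there the observable takes its largest value. *)
Lemma oscillation_contracts g : mono_on iota E2 g ->
  iter N K2 g T - iter N K2 g B <= (1 - c) * (g T - g B).
Proof.
move=> mg.
have up : iter N K2 g T <= g T.
  rewrite -[leRHS](K2cst (g T) N T); apply: iter_idle_le (phase_top_sub _ _) => //; first by
      case: att2.
  by move=> w wE; apply: mg; rewrite ?phase_top_sub ?phase_le_top.
have lo : g B + (g T - g B) * c <= iter N K2 g B.
  rewrite /c -iter_step_opZ -{1}(K2cst (g B) N B) -iter_step_opD.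
  apply: iter_idle_le (phase_bot_sub _ _) => //; first by case: att2.
  move=> w wE; have [->|_] := eqVneq w T; first by rewrite mulr1 subrKC.
  by rewrite mulr0 addr0; apply: mg; rewrite ?phase_bot_sub ?phase_bot_le.
lra.
Qed.

Lemma iter_oscillation g k : mono_on iota E2 g ->
  iter (k * N) K2 g T - iter (k * N) K2 g B <= (1 - c) ^+ k * (g T - g B).
Proof.
move=> mg; elim: k => [|k IH]; first by rewrite mul1r.
rewrite mulSn !iterD exprS -mulrA.
apply: le_trans (oscillation_contracts _) _; first exact: iter_idle_mono.
by apply: ler_wpM2l => //; rewrite subr_ge0.
Qed.

(** Holley's inequality, read off from the dynamics. The mean of [h] under [nu1] does
    not change when [h] evolves under the first chain, hence is at most the largest
    value of [h] evolved under the second chain; the latter evolution flattens [h] to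
    its mean under [nu2]. *)
Theorem holley h : mono_on iota E2 h ->
  expect nu1 (fun w => h (w :&: E2)) <= expect nu2 h.
Proof.
move=> mh.
have bound k : expect nu1 (fun w => h (w :&: E2)) - expect nu2 h <= (1 - c) ^+ k * (h T - h B).
  apply: le_trans (iter_oscillation k mh); apply: lerB.
    rewrite -(@expect_iter_step_op _ _ _ E1 (idle_outside E1 (heat_bath alpha1 [set: {set I}]))
        _ _ (k * N)) //; last first.
      move=> i f iE; rewrite -(nu1_stat f iE); apply: eq_bigr => w _.
      by rewrite expect_idle iE.
    rewrite -(expect_cst (iter _ K2 h T) nu1_sum1); apply: ler_expect => // w nw.
    have wE : w \subset E1 by apply: contraNT nw => /nu1_supp ->.
    apply: le_trans (iter_idle_compare _ att1 att2 sub21 _ cmp mh wE) _ => //.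
    apply: (iter_idle_mono _ att2 sub21 mh); rewrite ?phase_top_sub ?finset.subsetIr//.
    by apply: phase_le_top; exact: finset.subsetIr.
  rewrite -[leRHS](@expect_iter_step_op _ _ _ E1 (idle_outside E2 (heat_bath alpha2 [set: {set
      I}])) _ _ (k * N)) //; last first.
    move=> i f iE; have [i2|i2] := boolP (i \in E2); last first.
      by apply: eq_bigr => w _; rewrite expect_idle (negPf i2).
    rewrite -(nu2_stat f i2); apply: eq_bigr => w _.
    by rewrite expect_idle i2.
  rewrite -(expect_cst (iter _ K2 h B) nu2_sum1); apply: ler_expect => // w nw.
  have wE : w \subset E2 by apply: contraNT nw => /nu2_supp ->.
  apply: (iter_idle_mono _ att2 sub21 mh); rewrite ?phase_bot_sub//.
  exact: phase_bot_le.
rewrite -subr_le0.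
have cv : (fun k => (1 - c) ^+ k * (h T - h B)) @ \oo --> (0 : R).
  rewrite -[X in _ --> X](mul0r (h T - h B)); apply: cvgMr_tmp.
  by apply: cvg_expr; rewrite ger0_norm ?subr_ge0//; have := c_gt0; lra.
by apply: (cvgr_to_ge cv); exact: nearW.
Qed.

End Holley.

(** * Clusters and bridges *)

Section Connectivity.
Context {V : finType}.
Implicit Types (A : {set V}) (w : {set {set V}}) (xi : {set {set V}}) (u v x y z : V).

Lemma linked_sym xi w : symmetric (linked xi w).
Proof.
move=> x y; rewrite /linked/= finset.setUC; congr (_ || _).
by apply: eq_existsb => B; rewrite [(x \in B) && _]andbC.
Qed.

Lemma connect_linked_sym xi w : connect_sym (linked xi w).
Proof. apply: sym_connect_sym; exact: linked_sym. Qed.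

Lemma set2_eqP x y u v : reflect (x = u /\ y = v \/ x = v /\ y = u)
  ([set x; y]%SET == [set u; v]%SET).
Proof.
apply: (iffP eqP) => [E|[[-> ->]//|[-> ->]]]; last by rewrite finset.setUC.
have : x \in [set u; v]%SET by rewrite -E !inE eqxx.
have : y \in [set u; v]%SET by rewrite -E !inE eqxx orbT.
have : u \in [set x; y]%SET by rewrite E !inE eqxx.
have : v \in [set x; y]%SET by rewrite E !inE eqxx orbT.
rewrite !inE => /orP[]/eqP? /orP[]/eqP? /orP[]/eqP? /orP[]/eqP?; subst; by [left|right].
Qed.

Lemma linkedU1 xi w u v x y : linked xi ([set u; v]%SET |: w) x y =
  ([set x; y]%SET == [set u; v]%SET) || linked xi w x y.
Proof. by rewrite /linked/= !inE -orbA. Qed.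

Lemma linked_mono xi w w' x y : w \subset w' -> linked xi w x y -> linked xi w' x y.
Proof.
by rewrite /linked/= => sw /orP[/(fintype.subsetP sw) ->//|->]; rewrite orbT.
Qed.

Lemma connect_linked_mono xi w w' x y : w \subset w' ->
  connect (linked xi w) x y -> connect (linked xi w') x y.
Proof.
by move=> sw; apply: connect_sub => a b /(linked_mono sw); exact: connect1.
Qed.

(** A path through the new edge can be shortened so as to use it once. *)
Lemma connect_linkedU1 xi w u v x y (c := connect (linked xi w)) :
  connect (linked xi ([set u; v]%SET |: w)) x y =
  [|| c x y, c x u && c v y | c x v && c u y].
Proof.
have cs := connect_linked_sym xi w; have ct := @connect_trans _ (linked xi w).
apply/idP/idP => [/connectP[s]|].
  elim: s x => [x _ ->|z s IH x /= /andP[xz zs] ly]; first by rewrite /c connect0.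
  have {zs ly} := IH z zs ly; move: xz; rewrite -/(linked _ _ _ _) => xz.
  have : linked xi ([set u; v]%SET |: w) x z by [].
  rewrite linkedU1 => /orP[/set2_eqP[[-> ->]|[-> ->]]|/connect1 cxz].
  - rewrite /c !connect0 /=; by case/or3P => [h|/andP[_ h]|h]; rewrite h ?orbT.
  - rewrite /c !connect0 /=; by case/or3P => [h|h|/andP[_ h]]; rewrite h ?orbT.
  - case/or3P => [h|/andP[h1 h2]|/andP[h1 h2]]; apply/or3P.
    + by apply: Or31; exact: ct cxz h.
    + by apply: Or32; rewrite /c (ct _ _ _ cxz h1).
    + by apply: Or33; rewrite /c (ct _ _ _ cxz h1).
have mono a b : c a b -> connect (linked xi ([set u; v]%SET |: w)) a b.
  by apply: connect_linked_mono; exact: finset.subsetUr.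
have uv : connect (linked xi ([set u; v]%SET |: w)) u v.
  by apply: connect1; rewrite linkedU1 eqxx.
have vu : connect (linked xi ([set u; v]%SET |: w)) v u by rewrite connect_linked_sym.
case/or3P => [/mono//|/andP[/mono h1 /mono h2]|/andP[/mono h1 /mono h2]].
  exact: connect_trans h1 (connect_trans uv h2).
exact: connect_trans h1 (connect_trans vu h2).
Qed.

Lemma connect_linkedU1_joined xi w u v x y : connect (linked xi w) u v ->
  connect (linked xi ([set u; v]%SET |: w)) x y = connect (linked xi w) x y.
Proof.
move=> uv; rewrite connect_linkedU1; apply/idP/idP => [|->//].
have vu : connect (linked xi w) v u by rewrite connect_linked_sym.
case/or3P => [//|/andP[h1 h2]|/andP[h1 h2]].
  exact: connect_trans h1 (connect_trans uv h2).
exact: connect_trans h1 (connect_trans vu h2).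
Qed.

Definition fk_cluster A xi w x : {set V} := [set y in A | connect (linked xi w) x y].

Lemma componentsE A xi w : components A xi w = [set fk_cluster A xi w x | x in A]%SET.
Proof. by []. Qed.

Lemma eq_components A xi w w' :
  (forall x y, connect (linked xi w) x y = connect (linked xi w') x y) ->
  components A xi w = components A xi w'.
Proof.
move=> H; rewrite !componentsE; apply: eq_imset => x.
by apply/finset.setP => y; rewrite !inE H.
Qed.

Lemma fk_cluster_eq A xi w x y : connect (linked xi w) x y ->
  fk_cluster A xi w x = fk_cluster A xi w y.
Proof.
move=> xy; apply/finset.setP => z; rewrite !inE; congr (_ && _).
exact: (same_connect (connect_linked_sym xi w) xy).
Qed.

(** The new edge merges the clusters of its endpoints and changes no other. *)
Lemma card_components_merge A xi w u v : u \in A -> v \in A ->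
  ~~ connect (linked xi w) u v ->
  #|components A xi w| = #|components A xi ([set u; v]%SET |: w)|.+1.
Proof.
move=> uA vA nuv; set w1 := _ |: w.
pose cl := fk_cluster A xi w; pose m := cl u :|: cl v.
have cs := connect_linked_sym xi w.
have cl1 x : x \in A -> fk_cluster A xi w1 x = if x \in m then m else cl x.
  move=> xA; have xm : (x \in m) = connect (linked xi w) x u || connect (linked xi w) x v.
    by rewrite !inE xA/= cs [connect _ v x]cs.
  apply/finset.setP => y; rewrite inE connect_linkedU1 xm.
  have [xu|xu] := boolP (connect _ x u); rewrite /= ?andbT.
    have -> : connect (linked xi w) x v = false.
      by rewrite (same_connect cs xu); exact: negbTE.
    by rewrite !inE (same_connect cs xu) andFb orbF -andb_orr.
  have [xv|xv] := boolP (connect _ x v); rewrite /= ?andbT.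
    by rewrite !inE (same_connect cs xv) -andb_orr orbC.
  by rewrite !orbF !inE.
have compE : components A xi w1 = m |: (components A xi w :\ cl u :\ cl v).
  apply/finset.setP => X; apply/imsetP/idP => [[x xA ->]|].
    rewrite -/(fk_cluster A xi w1 x) cl1//; case: ifP => xm; rewrite finset.in_setU1 ?eqxx//.
    apply/orP; right; rewrite !inE; apply/and3P; split.
    - apply: contraFN xm => /eqP xv; rewrite inE -xv; apply/orP; right.
      by rewrite inE xA connect0.
    - apply: contraFN xm => /eqP xv; rewrite inE -xv; apply/orP; left.
      by rewrite inE xA connect0.
    - by apply/imsetP; exists x.
  rewrite finset.in_setU1 => /orP[/eqP ->|].
    exists u => //; rewrite -/(fk_cluster A xi w1 u) cl1//.
    by rewrite !inE uA connect0.
  rewrite !inE => /and3P[Xv Xu /imsetP[x xA XE]]; exists x => //.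
  rewrite -/(fk_cluster A xi w1 x) cl1//; case: ifP => //.
  rewrite !inE xA/= => /orP[ux|vx].
    by move: Xu; rewrite XE eq_sym /cl (fk_cluster_eq A ux) eqxx.
  by move: Xv; rewrite XE eq_sym /cl (fk_cluster_eq A vx) eqxx.
have uv : cl u != cl v.
  apply: contraNneq nuv => /finset.setP/(_ v); rewrite !inE vA connect0/=.
  by move=> ->.
have clC x : x \in A -> cl x \in components A xi w by move=> xA; apply/imsetP; exists x.
have mC : m \notin components A xi w :\ cl u :\ cl v.
  apply/negP; rewrite !inE => /and3P[_ _ /imsetP[x xA mE]].
  have : u \in m by rewrite !inE uA connect0.
  have : v \in m by rewrite !inE vA connect0 orbT.
  rewrite mE !inE => /andP[_ xv] /andP[_ xu]; move/negP: nuv; apply.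
  by rewrite -(same_connect cs xu).
rewrite compE cardsU1 mC (cardsD1 (cl u)) clC// (cardsD1 (cl v) (_ :\ _)).
by rewrite in_setD1 eq_sym uv clC.
Qed.

Lemma setU1D1 w e : e |: w = e |: (w :\ e).
Proof. by apply/finset.setP => f; rewrite !inE; case: eqP. Qed.

Lemma is_bridgeE A xi w u v : u \in A -> v \in A ->
  is_bridge A xi w [set u; v]%SET = ~~ connect (linked xi (w :\ [set u; v]%SET)) u v.
Proof.
move=> uA vA; rewrite /is_bridge setU1D1.
have [uv|uv] := boolP (connect _ u v).
  apply/negbTE; rewrite negbK; apply/eqP; congr #|pred_of_set _|.
  by apply: eq_components => x y; exact: connect_linkedU1_joined.
by rewrite [X in _ != X](card_components_merge uA vA uv) neq_ltn ltnSn.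
Qed.

Definition edges_in A (E : {set {set V}}) : Prop :=
  forall e, e \in E -> exists u v, [/\ u \in A, v \in A & e = [set u; v]%SET].

End Connectivity.

(** * Random-cluster weights and detailed balance *)

Section RandomClusterLaw.
Context {R : realType} {V : finType}.
Variables (p q : R).
Hypothesis p01 : 0 < p < 1.
Hypothesis q1 : 1 <= q.
Implicit Types (A : {set V}) (E w : {set {set V}}) (xi : {set {set V}}) (e : {set V})
  (S : {set {set {set V}}}).

Let p0 : 0 < p. Proof. by case/andP: p01. Qed.
Let p1 : 0 < 1 - p. Proof. by rewrite subr_gt0; case/andP: p01. Qed.
Let q0 : 0 < q. Proof. exact: lt_le_trans q1. Qed.
Let den_ge1 : 1 <= q * (1 - p) + p.
Proof. have := ler_wpM2r (ltW p1) q1; lra. Qed.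
Let den_gt0 : 0 < q * (1 - p) + p. Proof. exact: lt_le_trans den_ge1. Qed.

Lemma bridge_prob_le : p / (q * (1 - p) + p) <= p.
Proof. by rewrite ler_pdivrMr// ler_peMr// ltW. Qed.

Lemma open_prob_in A xi w e : 0 < open_prob p q A xi w e < 1.
Proof.
have /andP[_ pl] := p01; rewrite /open_prob; case: ifP => _; last by rewrite p0.
by rewrite divr_gt0//= (le_lt_trans bridge_prob_le).
Qed.

Lemma open_prob_in_le A xi w e : 0 <= open_prob p q A xi w e <= 1.
Proof. by have /andP[h1 h2] := open_prob_in A xi w e; rewrite !ltW. Qed.

Lemma fk_update_ge0 A xi S e w w' : 0 <= fk_update p q A xi S e w w'.
Proof. by apply: heat_bath_ge0 => *; exact: open_prob_in_le. Qed.

Lemma fk_update_sum1 A xi S e w : \sum_w' fk_update p q A xi S e w w' = 1.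
Proof. exact: heat_bath_sum1. Qed.

(** A bridge opens with probability [p / (q * (1 - p) + p)], which is at most [p] because
    [1 <= q]. *)
Lemma open_prob_le A A' xi xi' w w' e :
  (is_bridge A' xi' w' e -> is_bridge A xi w e) ->
  open_prob p q A xi w e <= open_prob p q A' xi' w' e.
Proof.
rewrite /open_prob => H; case: ifP => b; case: ifP => b' //; first exact: bridge_prob_le.
by rewrite H in b.
Qed.

(** A larger configuration has fewer bridges. *)
Lemma open_prob_attractive A E xi : edges_in A E -> attractive E (open_prob p q A xi).
Proof.
move=> EA; split => [w e|w w' e eE ww']; first exact: open_prob_in_le.
have [u [v [uA vA ->]]] := EA _ eE.
apply: open_prob_le; rewrite !is_bridgeE//; apply: contraNN.
by apply: connect_linked_mono; exact: finset.setSD.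
Qed.

Lemma rc_weight_ge0 A E xi w : 0 <= rc_weight p q A E xi w.
Proof.
by rewrite /rc_weight; case: ifP => // _; rewrite !mulr_ge0// exprn_ge0// ltW.
Qed.

Lemma rc_weight_gt0 A E xi w : w \subset E -> 0 < rc_weight p q A E xi w.
Proof.
by rewrite /rc_weight => ->; rewrite !mulr_gt0// exprn_gt0.
Qed.

Lemma rc_partition_gt0 A E xi : 0 < \sum_w rc_weight p q A E xi w.
Proof.
rewrite (bigD1 finset.set0)//= ltr_wpDr ?rc_weight_gt0 ?finset.sub0set//.
by apply: sumr_ge0 => w _; exact: rc_weight_ge0.
Qed.

Lemma rc_ge0 A E xi w : 0 <= rc p q A E xi w.
Proof. by rewrite divr_ge0 ?rc_weight_ge0// ltW// rc_partition_gt0. Qed.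

Lemma rc_sum1 A E xi : \sum_w rc p q A E xi w = 1.
Proof. by rewrite -mulr_suml divff// gt_eqF// rc_partition_gt0. Qed.

Lemma rc_supp A E xi w : ~~ (w \subset E) -> rc p q A E xi w = 0.
Proof. by rewrite /rc /rc_weight => /negPf ->; rewrite mul0r. Qed.

Lemma open_prob_D1 A xi w e : open_prob p q A xi (w :\ e) e = open_prob p q A xi w e.
Proof.
rewrite /open_prob /is_bridge -setU1D1; congr (if _ != _ then _ else _).
by congr #|pred_of_set (components _ _ _)|; apply/finset.setP => f; rewrite !inE andbA andbb.
Qed.

Lemma open_prob_U1 A xi w e : open_prob p q A xi (e |: w) e = open_prob p q A xi w e.
Proof.
rewrite -open_prob_D1 -[RHS]open_prob_D1; congr open_prob.
by apply/finset.setP => f; rewrite !inE; case: eqP.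
Qed.

(** Opening a bridge merges two clusters and costs a factor [q], which the smaller
    opening probability of a bridge compensates. *)
Lemma rc_weight_balance A E xi w e : edges_in A E -> e \in E -> e \notin w ->
  rc_weight p q A E xi w * open_prob p q A xi w e =
  rc_weight p q A E xi (e |: w) * (1 - open_prob p q A xi w e).
Proof.
move=> EA eE ew; rewrite /rc_weight finset.subUset finset.sub1set eE/=.
case: ifP => [wE|_]; last by rewrite !mul0r.
have wD : w :\ e = w by apply/finset.setDidPl; rewrite disjoint_sym disjoints1.
have cU : #|e |: w| = #|w|.+1 by rewrite cardsU1 ew.
have -> : (#|E| - #|w| = (#|E| - #|e |: w|).+1)%N.
  have := subset_leq_card (setU1_sub eE wE); rewrite cU => h; by rewrite -subSn.
rewrite cU !exprS /open_prob; have [u [v [uA vA eE']]] := EA _ eE.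
case: ifP => br; last first.
  move: br; rewrite /is_bridge wD => /negbT; rewrite negbK => /eqP ->.
  by move: (p ^+ #|w|) ((1 - p) ^+ _) (q ^+ _) => a b c; ring.
have := br; rewrite eE' is_bridgeE// -eE' wD => nuv.
rewrite (card_components_merge uA vA nuv) -eE' exprS.
have D0 : q * (1 - p) + p != 0 by rewrite gt_eqF.
by move: (p ^+ #|w|) ((1 - p) ^+ _) (q ^+ _) => a b c; field.
Qed.

(** Detailed balance survives the rejection of the moves out of [S]: rejection only
    changes the diagonal of the kernel on [S]. *)
Lemma rc_reversible A E xi S (c : R) e w w' : edges_in A E -> e \in E ->
  let nu w := c * ((w \in S)%:R * rc_weight p q A E xi w) in
  nu w * heat_bath (open_prob p q A xi) S e w w' =
  nu w' * heat_bath (open_prob p q A xi) S e w' w.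
Proof.
move=> EA eE nu.
have out v v' : v \in S -> v' \notin S -> heat_bath (open_prob p q A xi) S e v v' = 0.
  move=> vS v'S; rewrite /heat_bath.
  have H (u : {set {set V}}) : (v' == (if u \in S then u else v)) = false.
    by apply: contraNF v'S => /eqP ->; case: ifP.
  by rewrite !H !mulr0 addr0.
have [->//|ww'] := eqVneq w w'.
have [wS|wS] := boolP (w \in S); last first.
  have nw : nu w = 0 by rewrite /nu (negPf wS) mul0r mulr0.
  rewrite nw mul0r; have [w'S|w'S] := boolP (w' \in S); first by rewrite out ?mulr0.
  by rewrite /nu (negPf w'S) mul0r mulr0 mul0r.
have [w'S|w'S] := boolP (w' \in S); last first.
  by rewrite out// mulr0 /nu (negPf w'S) mul0r mulr0 mul0r.
have acc v v' u : v' \in S -> v != v' -> (v' == (if u \in S then u else v)) = (v' == u).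
  move=> v'S vv'; case: ifP => // uS; rewrite [LHS]eq_sym (negPf vv').
  by apply/esym; apply: contraFF uS => /eqP <-.
have w'w : w' != w by rewrite eq_sym.
rewrite /heat_bath !acc//.
have half v v' : v != v' -> v \in S -> v' \in S ->
  nu v * (open_prob p q A xi v e * (e |: v == v')%:R) =
  nu v' * ((1 - open_prob p q A xi v' e) * (v == v' :\ e)%:R).
  move=> vv' vS v'S; have [E1|E1] := eqVneq (e |: v) v'.
    have ev : e \notin v.
      apply: contra_neqN vv' => ev; rewrite -E1; apply/esym/finset.setUidPr.
      by rewrite finset.sub1set.
    have -> : v == v' :\ e by rewrite -E1 finset.setU1K.
    rewrite !mulr1 /nu vS v'S -E1 open_prob_U1 !mul1r -!mulrA.
    by rewrite (rc_weight_balance _ EA eE ev).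
  have [E2|E2] := eqVneq v (v' :\ e); last by rewrite !mulr0.
  have [ev|ev] := boolP (e \in v').
    by move: E1; rewrite E2 finset.setD1K// eqxx.
  move: vv'; rewrite E2; have -> : v' :\ e = v' by apply/finset.setDidPl; rewrite disjoint_sym
      disjoints1.
  by rewrite eqxx.
rewrite !mulrDr addrC; congr (_ + _).
  by rewrite -(half _ _ w'w w'S wS) [w == _]eq_sym.
by rewrite -(half _ _ ww' wS w'S) [w' == _]eq_sym.
Qed.

Lemma rc_stationary A E xi S (c : R) e h : edges_in A E -> e \in E ->
  let nu w := c * ((w \in S)%:R * rc_weight p q A E xi w) in
  \sum_w nu w * expect (heat_bath (open_prob p q A xi) S e w) h = expect nu h.
Proof.
move=> EA eE nu; rewrite /expect; under eq_bigr do rewrite mulr_sumr.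
rewrite exchange_big/=; apply: eq_bigr => w' _.
under eq_bigr do rewrite mulrA (rc_reversible _ _ _ _ _ EA eE) -/(nu w') mulrAC.
by rewrite -mulr_sumr heat_bath_sum1 mulr1.
Qed.

End RandomClusterLaw.

(** * Transport along injections of the vertices *)

Section Transport.
Context {V V' : finType} (phi : V -> V').
Hypothesis phi_inj : injective phi.
Implicit Types (A e : {set V}) (E w xi : {set {set V}}) (x y : V).

(** The action of a vertex map on edge sets and on partitions alike. *)
Definition map_sets (w : {set {set V}}) : {set {set V'}} := ((fun e : {set V} => (phi @:
    e)%SET) @: w)%SET.

Let imset_phi_inj : injective (fun e : {set V} => phi @: e)%SET.
Proof. exact: imset_inj. Qed.

Lemma map_sets_inj : injective map_sets.
Proof. exact: imset_inj. Qed.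

Lemma mem_map_sets e w : ((phi @: e)%SET \in map_sets w) = (e \in w).
Proof. exact: mem_imset. Qed.

Lemma map_setsU1 e w : map_sets (e |: w) = ((phi @: e)%SET |: map_sets w).
Proof. by rewrite /map_sets imsetU imset_set1. Qed.

Lemma map_setsD1 e w : map_sets (w :\ e) = (map_sets w :\ (phi @: e)%SET).
Proof.
apply/finset.setP => f; rewrite in_setD1; apply/imsetP/andP => [[g]|[fe /imsetP[g gw fE]]].
  rewrite in_setD1 => /andP[ge gw ->]; split; last by rewrite mem_map_sets.
  by rewrite (inj_eq imset_phi_inj).
exists g => //; rewrite in_setD1 gw andbT; apply: contraNneq fe => <-.
by rewrite fE.
Qed.

Lemma map_sets_sub w E : (map_sets w \subset map_sets E) = (w \subset E).
Proof.
apply/fintype.subsetP/fintype.subsetP => sw e; last first.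
  by case/imsetP => f /sw fE ->; rewrite mem_map_sets.
by rewrite -mem_map_sets => /sw; rewrite mem_map_sets.
Qed.

Lemma card_map_sets w : #|map_sets w| = #|w|.
Proof. by rewrite card_imset. Qed.

Lemma linked_map xi w x y :
  linked (map_sets xi) (map_sets w) (phi x) (phi y) = linked xi w x y.
Proof.
rewrite /linked/=; congr (_ || _).
  by rewrite -mem_map_sets imsetU !imset_set1.
apply/existsP/existsP => [[B /and3P[/imsetP[C Cxi ->]]]|[B /and3P[Bxi xB yB]]].
  by rewrite !mem_imset// => xC yC; exists C; rewrite Cxi xC.
by exists (phi @: B)%SET; rewrite mem_map_sets Bxi !mem_imset// xB.
Qed.

Lemma linked_map_image xi w x z : linked (map_sets xi) (map_sets w) (phi x) z ->
  exists y, z = phi y.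
Proof.
rewrite /linked/= => /orP[/imsetP[e _ /finset.setP/(_ z)]|].
  by rewrite !inE eqxx orbT => /esym/imsetP[y _ ->]; exists y.
by case/existsP => B /and3P[/imsetP[C _ ->] _ /imsetP[y _ ->]]; exists y.
Qed.

(** Nothing outside the image of [phi] is linked to it, so paths can be pulled back. *)
Lemma connect_map xi w x y :
  connect (linked (map_sets xi) (map_sets w)) (phi x) (phi y) = connect (linked xi w) x y.
Proof.
apply/connectP/connectP => [[s]|[s xs ->]]; last first.
  exists (map phi s); last by rewrite last_map.
  elim: s x xs => //= z s IH x /andP[xz /IH ->]; rewrite andbT.
  by have := xz; rewrite -/(linked _ _ _ _) -linked_map.
elim: s x => [x _ /phi_inj ->|z s IH x /= /andP[xz]]; first by exists [::].
have [u zu] := linked_map_image xz; rewrite zu in xz *.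
move=> /IH H /H[s' us' ->]; exists (u :: s') => //=; rewrite us' andbT.
by have := xz; rewrite -/(linked _ _ _ _) linked_map.
Qed.

Lemma components_map A xi w :
  components (phi @: A)%SET (map_sets xi) (map_sets w) = map_sets (components A xi w).
Proof.
have cl x : fk_cluster (phi @: A)%SET (map_sets xi) (map_sets w) (phi x) = (phi @: fk_cluster A
    xi w x)%SET.
  apply/finset.setP => z; rewrite inE; apply/andP/imsetP => [[/imsetP[y yA ->]]|[y]].
    by rewrite connect_map => xy; exists y; rewrite ?inE ?yA.
  by rewrite inE => /andP[yA xy] ->; rewrite connect_map mem_imset.
rewrite !componentsE; apply/finset.setP => X; apply/imsetP/imsetP => [[z /imsetP[x xA ->]
    ->]|[Y /imsetP[x xA ->] ->]].
  by exists (fk_cluster A xi w x) => //; apply/imsetP; exists x.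
by exists (phi x); rewrite ?mem_imset.
Qed.

Lemma largest_component_map A xi w :
  largest_component (phi @: A)%SET (map_sets xi) (map_sets w) = largest_component A xi w.
Proof.
rewrite /largest_component components_map big_imset/=; last by move=> ? ? _ _; exact:
    imset_phi_inj.
by apply: eq_bigr => B _; rewrite card_imset.
Qed.

Section Law.
Context {R : realType} (p q : R).

Lemma open_prob_map A xi w e :
  open_prob p q (phi @: A)%SET (map_sets xi) (map_sets w) (phi @: e)%SET = open_prob p q A xi w e.
Proof.
by rewrite /open_prob /is_bridge -map_setsU1 -map_setsD1 !components_map !card_map_sets.
Qed.

Lemma rc_weight_map A E xi w :
  rc_weight p q (phi @: A)%SET (map_sets E) (map_sets xi) (map_sets w) = rc_weight p q A E xi w.
Proof. by rewrite /rc_weight map_sets_sub components_map !card_map_sets. Qed.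

Lemma sum_map_sets E (F : {set {set V'}} -> R) :
  (forall w' : {set {set V'}}, ~~ (w' \subset map_sets E) -> F w' = 0) ->
  \sum_(w' : {set {set V'}}) F w' = \sum_w F (map_sets w).
Proof.
move=> F0; rewrite (bigID (fun w' : {set {set V'}} => w' \subset map_sets E))/= [X in _ +
    X]big1 ?addr0; last first.
  by move=> w' /F0.
rewrite [RHS](bigID (fun w => w \subset E))/= [X in _ = _ + X]big1 ?addr0; last first.
  by move=> w wE; rewrite F0// map_sets_sub.
rewrite [RHS](eq_bigl (fun w => w \in finset.powerset E)); last by move=> w; rewrite
    finset.powersetE.
rewrite -[RHS](big_imset (h := map_sets) F)/=; last by move=> ? ? _ _; exact: map_sets_inj.
apply: eq_bigl => w'; apply/idP/imsetP => [sw|[w]]; last first.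
  by rewrite finset.powersetE => wE ->; rewrite map_sets_sub.
exists [set e in E | (phi @: e)%SET \in w']; first by rewrite finset.powersetE;
    apply/fintype.subsetP => e; rewrite inE => /andP[].
apply/finset.setP => f; apply/idP/imsetP => [fw|[e]]; last by rewrite inE => /andP[_ ? ->].
by have /imsetP[e eE fE] := fintype.subsetP sw _ fw; exists e; rewrite // inE eE -fE.
Qed.

Lemma expect_rc_map A E xi (h : {set {set V'}} -> R) :
  expect (rc p q (phi @: A)%SET (map_sets E) (map_sets xi)) h =
  expect (rc p q A E xi) (h \o map_sets).
Proof.
have W0 (w' : {set {set V'}}) : ~~ (w' \subset map_sets E) ->
    rc_weight p q (phi @: A)%SET (map_sets E) (map_sets xi) w' = 0.
  by rewrite /rc_weight => /negPf ->.
rewrite /expect (@sum_map_sets E) => [|w' nw]; last by rewrite /rc W0 ?mul0r.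
apply: eq_bigr => w _; rewrite /rc rc_weight_map (@sum_map_sets E)//.
by under [X in _ / X]eq_bigr do rewrite rc_weight_map.
Qed.

Lemma fk_step_map A E xi (h : {set {set V'}} -> R) w :
  step_op (map_sets E) (fk_update p q (phi @: A)%SET (map_sets xi) [set: {set {set V'}}]) h
      (map_sets w) =
  step_op E (fk_update p q A xi [set: {set {set V}}]) (h \o map_sets) w.
Proof.
rewrite /step_op card_map_sets big_imset/=; last by move=> ? ? _ _; exact: imset_phi_inj.
apply: eq_bigr => e _; congr (_ * _).
rewrite -/(expect (heat_bath (open_prob p q _ _) _ _ _) _).
rewrite -[RHS]/(expect (heat_bath (open_prob p q A xi) _ e w) _).
by rewrite !expect_heat_bathT/= open_prob_map map_setsU1 map_setsD1.
Qed.

Hypothesis p01 : 0 < p < 1.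
Hypothesis q1 : 1 <= q.

Lemma expect_fk_law_map A E xi w0 t (h : {set {set V'}} -> R) : 0 <= t ->
  expect (fk_law p q (phi @: A)%SET (map_sets E) (map_sets xi) [set: {set {set V'}}] (map_sets
      w0) t) h =
  expect (fk_law p q A E xi [set: {set {set V}}] w0 t) (h \o map_sets).
Proof.
move=> t0.
have c1 := expect_clock_law_cvg (E := map_sets E) (x0 := map_sets w0) (h := h)
  (@fk_update_ge0 R _ p q p01 q1 (phi @: A)%SET (map_sets xi) [set: {set {set V'}}])
      (@fk_update_sum1 R _ p q _ _ _) t0.
have c2 := expect_clock_law_cvg (E := E) (x0 := w0) (h := h \o map_sets)
  (@fk_update_ge0 R _ p q p01 q1 A xi [set: {set {set V}}]) (@fk_update_sum1 R _ p q _ _ _) t0.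
have iterE j w : iter j (step_op (map_sets E) (fk_update p q (phi @: A)%SET (map_sets xi) [set:
    {set {set V'}}])) h (map_sets w)
    = iter j (step_op E (fk_update p q A xi [set: {set {set V}}])) (h \o map_sets) w.
  elim: j w => [//|j IH] w; rewrite !iterS fk_step_map.
  by congr (step_op _ _ _ _); exact/funext.
move: c1; under eq_fun do under eq_bigr do rewrite iterE.
rewrite card_map_sets => c1; exact: (cvg_unique _ c1 c2).
Qed.

End Law.
End Transport.

(** * Domains of the torus *)

Section TorusGraph.
Context {d n : nat}.
Implicit Types (x y u v : torus d n) (A : {set torus d n}) (e : {set torus d n}).

Lemma torus_edgeP x y : reflect (x != y /\ exists i, y = unit_shift i x \/ x = unit_shift i y)
  ([set x; y]%SET \in torus_edges).
Proof.
apply: (iffP idP) => [|[xy [i H]]].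
  rewrite inE => /existsP[z /existsP[i /andP[/set2_eqP[[-> ->]|[-> ->]] zi]]].
    by split => //; exists i; left.
  by rewrite eq_sym; split => //; exists i; right.
rewrite inE; apply/existsP; case: H => H.
  by exists x; apply/existsP; exists i; rewrite -H eqxx xy.
by exists y; apply/existsP; exists i; rewrite -H finset.setUC eqxx eq_sym xy.
Qed.

Lemma torus_edges_pair e : e \in torus_edges ->
  exists x i, e = [set x; unit_shift i x]%SET /\ x != unit_shift i x.
Proof. by rewrite inE => /existsP[x /existsP[i /andP[/eqP -> xi]]]; exists x, i. Qed.

Lemma induced_edgesT : induced_edges [set: torus d n] = torus_edges.
Proof. by apply/finset.setP => e; rewrite inE finset.subsetT andbT. Qed.

Lemma induced_edges_sub A : induced_edges A \subset torus_edges.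
Proof. by apply/fintype.subsetP => e; rewrite inE => /andP[]. Qed.

Lemma induced_edges_mono A A' : A' \subset A -> induced_edges A' \subset induced_edges A.
Proof.
move=> sA; apply/fintype.subsetP => e; rewrite !inE => /andP[-> /= eA].
exact: fintype.subset_trans sA.
Qed.

Lemma mem_induced_edges2 A x y : ([set x; y]%SET \in induced_edges A) =
  [&& [set x; y]%SET \in torus_edges, x \in A & y \in A].
Proof. by rewrite [LHS]inE finset.subUset !finset.sub1set. Qed.

Lemma edges_in_induced A : edges_in A (induced_edges A).
Proof.
move=> e eA; have := fintype.subsetP (induced_edges_sub A) _ eA.
move=> /torus_edges_pair[x [i [eE _]]]; exists x, (unit_shift i x).
by move: eA; rewrite eE mem_induced_edges2 => /and3P[_ -> ->].
Qed.

Lemma edges_in_torus : edges_in [set: torus d n] torus_edges.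
Proof. by rewrite -induced_edgesT; exact: edges_in_induced. Qed.

Lemma boundaryP A x : reflect (x \in A /\ exists y, y \notin A /\ [set x; y]%SET \in torus_edges)
  (x \in boundary A).
Proof.
rewrite [_ \in boundary A]inE; apply: (iffP andP) => [[xA /existsP[y /andP[? ?]]]|[xA [y [yA
    xy]]]].
  by split => //; exists y.
by split => //; apply/existsP; exists y; rewrite yA.
Qed.

Lemma boundary_sub A A' x : A' \subset A -> x \in A' -> x \in boundary A -> x \in boundary A'.
Proof.
move=> sA xA' /boundaryP[_ [y [yA xy]]]; apply/boundaryP; split => //.
by exists y; split => //; apply: contra yA; exact: fintype.subsetP.
Qed.

(** A path leaves and re-enters [A] through its boundary, which is a single wired
    class; its excursions can be replaced by jumps inside this class. *)
Lemma connect_wired_restrict A (xi : {set {set torus d n}}) (w : config d n) u v :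
  (forall B x, B \in xi -> x \in B -> x \in A -> x \in boundary A) ->
  w \subset torus_edges -> u \in A -> v \in A ->
  connect (linked xi w) u v ->
  connect (linked (bc Wired A) (w :&: induced_edges A)) u v.
Proof.
move=> xiA wE uA vA; set c := connect (linked (bc _ _) _).
have bdc a b : a \in boundary A -> b \in boundary A -> c a b.
  move=> aA bA; apply: connect1; rewrite /linked/=; apply/orP; right.
  by apply/existsP; exists (boundary A); rewrite inE eqxx aA.
(* what is left of the connection to u at a vertex outside A: any excursion has left
   through the boundary *)
pose inv x := if x \in A then c u x : Prop else forall b, b \in boundary A -> c u b.
have step x y : linked xi w x y -> inv x -> inv y.
  move=> xy.
  have [[xA [yA xyw]]|[xbd ybd]] :
      (x \in A /\ y \in A /\ [set x; y]%SET \in w) \/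
      ((x \in A -> x \in boundary A) /\ (y \in A -> y \in boundary A)).
    move: xy; rewrite /linked/= => /orP[xyw|]; last first.
      by case/existsP => B /and3P[Bxi xB yB]; right; split; exact: xiA Bxi _.
    have xyE := fintype.subsetP wE _ xyw.
    have [xA|xA] := boolP (x \in A); have [yA|yA] := boolP (y \in A).
    - by left.
    - by right; split => // _; apply/boundaryP; split => //; exists y.
    - right; split => // _; apply/boundaryP; split => //; exists x.
      by rewrite finset.setUC.
    - by right.
  - rewrite /inv xA yA => ux; apply: (connect_trans ux); apply: connect1.
    by rewrite /linked/= inE xyw mem_induced_edges2 xA yA (fintype.subsetP wE _ xyw).
  - have all_bd : inv x -> forall b, b \in boundary A -> c u b.
      rewrite /inv; case: ifP => [xA ux b bA|//].
      by apply: (connect_trans ux); apply: bdc => //; exact: xbd.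
    move=> /all_bd H; rewrite /inv; case: ifP => // yA; exact/H/ybd.
have invpath s x : path (linked xi w) x s -> inv x -> inv (last x s).
  elim: s x => //= y s IH x /andP[xy ys] ix; exact: IH ys (step _ _ xy ix).
case/connectP => s us vE; have := invpath s u us.
by rewrite -vE /inv uA vA; apply; exact: connect0.
Qed.

Lemma connect_free_restrict A (xi : {set {set torus d n}}) (w : config d n) u v :
  connect (linked (bc Free A) (w :&: induced_edges A)) u v -> connect (linked xi w) u v.
Proof.
apply: connect_sub => x y; rewrite /linked/= => /orP[|].
  by rewrite inE => /andP[xyw _]; apply: connect1; rewrite /= xyw.
case/existsP => B /and3P[/imsetP[z _ ->]]; rewrite !inE => /eqP -> /eqP ->.
exact: connect0.
Qed.

(** Wiring the boundary of a smaller domain can only create connections, and freeing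
    it can only destroy them. *)
Lemma open_prob_domain {R : realType} (p q : R) iota A A' (xi : {set {set torus d n}})
    (w : config d n) e : 0 < p < 1 -> 1 <= q -> A' \subset A ->
  (forall B x, B \in xi -> x \in B -> x \in A' -> x \in boundary A') ->
  w \subset induced_edges A -> e \in induced_edges A' ->
  phase_ler iota (open_prob p q A xi w e)
    (open_prob p q A' (bc iota A') (w :&: induced_edges A') e).
Proof.
move=> p01 q1 sA xiA wA eA'.
have [u [v [uA' vA' eE]]] := edges_in_induced eA'.
have uA := fintype.subsetP sA _ uA'; have vA := fintype.subsetP sA _ vA'.
have DI : (w :&: induced_edges A') :\ e = (w :\ e) :&: induced_edges A'.
  by rewrite finset.setIDAC.
case: iota => /=; apply: open_prob_le => //; rewrite eE !is_bridgeE// -eE DI; apply: contraNN.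
  exact: connect_free_restrict.
apply: connect_wired_restrict => //.
apply: (fintype.subset_trans (finset.subD1set _ _)).
exact: fintype.subset_trans (induced_edges_sub A).
Qed.

End TorusGraph.

(** * Local isomorphisms of tori *)

Section LocalIsomorphism.
Context {d n N : nat} (phi : torus d n -> torus d N).
Hypothesis phi_inj : injective phi.
Variable A : {set torus d n}.
Hypothesis phi_edge : forall x y, x \in A ->
  ([set phi x; phi y]%SET \in torus_edges) = ([set x; y]%SET \in torus_edges).
Hypothesis phi_nbr : forall x y', x \in A ->
  [set phi x; y']%SET \in torus_edges -> exists y, y' = phi y.
Local Notation A' := (phi @: A)%SET.

Lemma induced_edges_map : induced_edges A' = map_sets phi (induced_edges A).
Proof.
apply/finset.setP => e'; apply/idP/imsetP => [e'A|[e]].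
  have [u' [v' [/imsetP[u uA ->] /imsetP[v vA ->] eE]]] := edges_in_induced e'A.
  exists [set u; v]%SET; last by rewrite eE imsetU !imset_set1.
  move: e'A; rewrite eE !mem_induced_edges2 phi_edge// => /and3P[-> _ _].
  by rewrite uA vA.
move=> eA; have [u [v [uA vA eE]]] := edges_in_induced eA.
move: eA; rewrite eE mem_induced_edges2 => /and3P[uv _ _] ->.
by rewrite imsetU !imset_set1 mem_induced_edges2 phi_edge// uv !mem_imset// uA.
Qed.

Lemma boundary_map : boundary A' = (phi @: boundary A)%SET.
Proof.
apply/finset.setP => x'; apply/boundaryP/imsetP => [[/imsetP[x xA ->] [y' [y'A xy]]]|[x
    /boundaryP[xA [y [yA xy]]] ->]].
  exists x => //; apply/boundaryP; split => //.
  have [y yE] := phi_nbr xA xy; exists y; rewrite -phi_edge// -yE; split => //.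
  by apply: contra y'A => yA; rewrite yE mem_imset.
split; first by rewrite mem_imset.
by exists (phi y); rewrite mem_imset// phi_edge.
Qed.

Lemma bc_map iota : bc iota A' = map_sets phi (bc iota A).
Proof.
case: iota; rewrite /bc boundary_map /map_sets.
  rewrite -!imset_comp; apply: eq_imset => x /=.
  by rewrite imset_set1.
by rewrite imset_set1.
Qed.

Lemma extremal_map iota : extremal iota A' = map_sets phi (extremal iota A).
Proof. by case: iota; rewrite /extremal ?induced_edges_map// /map_sets imset0. Qed.

Lemma expect_pi_dom_map {R : realType} (p q : R) iota h :
  expect (pi_dom p q iota A') h = expect (pi_dom p q iota A) (h \o map_sets phi).
Proof. by rewrite /pi_dom induced_edges_map bc_map expect_rc_map. Qed.

Lemma expect_X_law_map {R : realType} (p q : R) iota t h : 0 < p < 1 -> 1 <= q -> 0 <= t ->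
  expect (X_law p q iota A' t) h = expect (X_law p q iota A t) (h \o map_sets phi).
Proof.
by move=> p01 q1 t0; rewrite /X_law induced_edges_map bc_map extremal_map expect_fk_law_map.
Qed.

Lemma agree_map {R : realType} iota (e : {set torus d n}) :
  (fun w => agree iota (phi @: e)%SET (map_sets phi w)) = agree iota e :> (_ -> R).
Proof. by apply/funext => w; rewrite /agree mem_map_sets. Qed.

End LocalIsomorphism.

(** * Translations of the torus *)

Section Translation.
Context {d n : nat}.
Local Notation V := (torus d n.+1).
Implicit Types (a x y : V) (e : {set V}).

Definition translate a x : V := x + a.

Lemma translate_inj a : injective (translate a).
Proof. exact: addIr. Qed.

Lemma translate_surj a y : exists x, y = translate a x.
Proof. by exists (y - a); rewrite /translate subrK. Qed.

Lemma translate_shift a i x : translate a (unit_shift i x) = unit_shift i (translate a x).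
Proof.
apply/ffunP => j; rewrite !ffunE; case: eqP => _ //.
by apply: val_inj; rewrite /= modnDml -[in RHS]addn1 modnDml addn1 addSn.
Qed.

Lemma translate_edge a x y :
  ([set translate a x; translate a y]%SET \in torus_edges) = ([set x; y]%SET \in torus_edges).
Proof.
apply/torus_edgeP/torus_edgeP; rewrite (inj_eq (@translate_inj a)) => -[xy [i H]]; split => //;
    exists i.
  by move: H; rewrite -!translate_shift => -[/translate_inj|/translate_inj]; [left|right].
by case: H => ->; rewrite translate_shift; [left|right].
Qed.

Lemma cyc_dist_translate (a x y : 'I_n.+1) : cyc_dist (x + a) (y + a) = cyc_dist x y.
Proof.
have addE (b : 'I_n.+1) : (b + a : 'I_n.+1) = (if b + a < n.+1 then b + a else b + a - n.+1)%N
    :> nat.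
  rewrite /=; case: ltnP => ba; first by rewrite modn_small.
  rewrite -[X in (X %% _)%N](subnK ba) modnDr modn_small//.
  by have := ltn_ord a; have := ltn_ord b; lia.
rewrite /cyc_dist /cyc_norm !addE.
by case: ltnP => h1; case: ltnP => h2; have := ltn_ord a; have := ltn_ord x; have := ltn_ord y;
    lia.
Qed.

Lemma translate_setT a : (translate a @: [set: V])%SET = [set: V].
Proof.
apply/finset.setP => x; rewrite !inE; have [y ->] := translate_surj a x.
by rewrite (mem_imset _ _ (@translate_inj a)) inE.
Qed.

Lemma translate_Ball a m e : Ball m (translate a @: e)%SET = (translate a @: Ball m e)%SET.
Proof.
apply/finset.setP => z; have [x ->] := translate_surj a z.
rewrite mem_imset; last exact: translate_inj.
rewrite !inE; apply/existsP/existsP => [[_ /andP[/imsetP[y ye ->]]]|[y /andP[ye]]] /forallP H.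
  exists y; rewrite ye; apply/forallP => i; have := H i.
  by rewrite !ffunE cyc_dist_translate.
exists (translate a y); rewrite mem_imset ?ye; last exact: translate_inj.
by apply/forallP => i; rewrite !ffunE cyc_dist_translate.
Qed.

Lemma translate_torus_edges a : map_sets (translate a) torus_edges = torus_edges.
Proof.
have := @induced_edges_map d n.+1 n.+1 _ (@translate_inj a) [set: V]
  (fun x y _ => translate_edge a x y).
by rewrite translate_setT induced_edgesT => <-.
Qed.

Lemma translate_pi_dom {R : realType} (p q : R) iota a m e h :
  expect (pi_dom p q iota (Ball m (translate a @: e)%SET)) h =
  expect (pi_dom p q iota (Ball m e)) (h \o map_sets (translate a)).
Proof.
rewrite translate_Ball; apply: expect_pi_dom_map; first exact: translate_inj.
  by move=> x y _; exact: translate_edge.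
by move=> x y' _ _; exact: translate_surj.
Qed.

Lemma translate_X_law {R : realType} (p q : R) iota a m e t h : 0 < p < 1 -> 1 <= q -> 0 <= t ->
  expect (X_law p q iota (Ball m (translate a @: e)%SET) t) h =
  expect (X_law p q iota (Ball m e) t) (h \o map_sets (translate a)).
Proof.
move=> p01 q1 t0; rewrite translate_Ball; apply: expect_X_law_map => //.
- exact: translate_inj.
- by move=> x y _; exact: translate_edge.
by move=> x y' _ _; exact: translate_surj.
Qed.

Lemma translate_Omega {R : realType} (eps : R) iota a (w : config d n.+1) :
  (map_sets (translate a) w \in Omega_phase d eps iota n.+1) = (w \in Omega_phase d eps iota
      n.+1).
Proof.
rewrite !inE -{1}(translate_torus_edges a) map_sets_sub; last exact: translate_inj.
have -> : C1_size (map_sets (translate a) w) = C1_size w.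
  have := largest_component_map (@translate_inj a) [set: V] finset.set0 w.
  by rewrite translate_setT /map_sets imset0.
by [].
Qed.

Lemma translate_pi_torus {R : realType} (p q : R) a h :
  expect (@pi_torus R d p q n.+1) h = expect (@pi_torus R d p q n.+1) (h \o map_sets (translate
      a)).
Proof.
have := expect_rc_map (@translate_inj a) p q [set: V] torus_edges finset.set0 h.
by rewrite translate_setT translate_torus_edges {1}/map_sets imset0.
Qed.

Lemma expect_pi_phase {R : realType} (p q eps : R) iota h :
  expect (pi_phase d p q eps iota n.+1) h =
  expect (@pi_torus R d p q n.+1) (fun w => (w \in Omega_phase d eps iota n.+1)%:R * h w) /
  expect (@pi_torus R d p q n.+1) (fun w => (w \in Omega_phase d eps iota n.+1)%:R).
Proof.
rewrite /expect mulr_suml; apply: eq_bigr => w _.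
rewrite /pi_phase /conditional.
have -> : prob (@pi_torus R d p q n.+1) (Omega_phase d eps iota n.+1) =
    \sum_x pi_torus p q x * (x \in Omega_phase d eps iota n.+1)%:R.
  rewrite /prob big_mkcond; apply: eq_bigr => x _.
  by case: ifP; rewrite ?mulr1 ?mulr0.
by case: ifP => _; rewrite ?mul1r ?mul0r ?mulr0 ?mul0r// mulrAC.
Qed.

Lemma translate_pi_phase {R : realType} (p q eps : R) iota a h :
  expect (pi_phase d p q eps iota n.+1) h =
  expect (pi_phase d p q eps iota n.+1) (h \o map_sets (translate a)).
Proof.
rewrite !expect_pi_phase (translate_pi_torus _ _ a); congr (_ / _).
by apply: eq_bigr => w _; rewrite /= translate_Omega.
Qed.

End Translation.

(** * Balls that do not wrap around *)

(** The shape of the ball around an edge in direction [i] whose first endpoint has all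
    coordinates [m.+1]; it stays clear of the seam of the torus. *)
Definition box (d n m : nat) (i : 'I_d) : {set torus d n} :=
  [set y : torus d n | [forall j, 0 < y j <= m.*2.+1 + (j == i)]]%N.

Lemma ordSE n (a : 'I_n) : ordS a = (if a.+1 == n then 0 else a.+1)%N :> nat.
Proof.
rewrite /=; case: eqP => [->|an]; first exact: modnn.
by rewrite modn_small//; have := ltn_ord a; lia.
Qed.

Lemma Ball_box (d n m : nat) (i : 'I_d) (x : torus d n) :
  (m.*2 + 4 <= n)%N -> (forall j, x j = m.+1 :> nat) ->
  Ball m [set x; unit_shift i x]%SET = box n m i.
Proof.
move=> mn xm.
have xSi j : unit_shift i x j = (m.+1 + (j == i))%N :> nat.
  rewrite ffunE; case: eqP => _; last by rewrite xm addn0.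
  by rewrite ordSE xm; case: eqP => ?; lia.
apply/finset.setP => y; rewrite !inE; apply/existsP/forallP => [[z /andP[]]|H].
  rewrite !inE => /orP[]/eqP -> /forallP H j; have := H j; rewrite /cyc_dist /cyc_norm ?xSi ?xm;
    have := ltn_ord (y j); case: eqP => _ /=; lia.
have [hi|hi] := leqP (y i) m.*2.+1.
  exists x; rewrite !inE eqxx; apply/forallP => j; have := H j.
  rewrite /cyc_dist /cyc_norm xm; have := ltn_ord (y j).
  case: eqP => [->|_] /=; last lia.
  by move: hi; move: (nat_of_ord (y i)) => a; lia.
exists (unit_shift i x); rewrite !inE eqxx orbT; apply/forallP => j; have := H j.
rewrite /cyc_dist /cyc_norm xSi; have := ltn_ord (y j).
case: eqP => [->|_] /=; last lia.
by move: hi; move: (nat_of_ord (y i)) => a; lia.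
Qed.

Section Embedding.
Context {d n N : nat} (leN : (n <= N)%N) (m : nat) (i : 'I_d).
Hypothesis mn : (m.*2 + 4 <= n)%N.
Implicit Types (x y : torus d n).

Definition embed x : torus d N := [ffun j => widen_ord leN (x j)].

Lemma embedE x j : embed x j = x j :> nat.
Proof. by rewrite ffunE. Qed.

Lemma embed_inj : injective embed.
Proof.
by move=> x y xy; apply/ffunP => j; apply: val_inj; rewrite /= -!embedE xy.
Qed.

Lemma mem_box_embed x : (embed x \in box N m i) = (x \in box n m i).
Proof. by rewrite !inE; apply: eq_forallb => j; rewrite embedE. Qed.

Lemma embed_box : (embed @: box n m i)%SET = box N m i.
Proof.
apply/finset.setP => z; apply/imsetP/idP => [[x xb ->]|zb]; first by rewrite mem_box_embed.
have zn j : (z j < n)%N.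
  move: zb; rewrite inE => /forallP/(_ j); move: (nat_of_ord (z j)) => a.
  by case: (j == i) => /=; lia.
have zE : z = embed [ffun j => Ordinal (zn j)].
  by apply/ffunP => j; apply: val_inj; rewrite !ffunE.
by exists [ffun j => Ordinal (zn j)]; rewrite -?mem_box_embed -?zE.
Qed.

Lemma box_interior x j : x \in box n m i -> (0 < x j < n.-1)%N.
Proof.
rewrite inE => /forallP/(_ j); move: (nat_of_ord (x j)) => a.
by case: (j == i) => /=; lia.
Qed.

Lemma embed_shift x k : x \in box n m i -> embed (unit_shift k x) = unit_shift k (embed x).
Proof.
move=> xb; apply/ffunP => j; rewrite !ffunE; case: eqP => _ //.
apply: val_inj; have := box_interior j xb; rewrite /=; move: (nat_of_ord (x j)) => a an.
by rewrite !modn_small//; lia.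
Qed.

Lemma embed_shift_back x y k : x \in box n m i ->
  (embed x = unit_shift k (embed y)) <-> (x = unit_shift k y).
Proof.
move=> xb; have coord j : nat_of_ord (unit_shift k (embed y) j) = embed x j :> nat <->
    nat_of_ord (unit_shift k y j) = x j.
  have := box_interior j xb; have := ltn_ord (y j).
  rewrite embedE !ffunE; case: eqP => _ //.
  rewrite !ordSE /=; move: (nat_of_ord (x j)) (nat_of_ord (y j)) => a b.
  by move=> bn an; case: eqP => h1; case: eqP => h2; split; lia.
by split => E; apply/ffunP => j; apply: val_inj => /=; apply/esym/coord; rewrite -E.
Qed.

Lemma embed_edge x y : x \in box n m i ->
  ([set embed x; embed y]%SET \in torus_edges) = ([set x; y]%SET \in torus_edges).
Proof.
move=> xb; apply/torus_edgeP/torus_edgeP; rewrite (inj_eq embed_inj) => -[xy [k H]]; split =>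
    //; exists k.
  by move: H; rewrite -embed_shift// embed_shift_back// => -[/embed_inj|]; [left|right].
by case: H => H; [left; rewrite H embed_shift | right; rewrite embed_shift_back].
Qed.

(** The neighbours of the box have coordinates below [n] as well, so the boundary of
    the box is the same in both tori. *)
Lemma embed_nbr x (z : torus d N) : x \in box n m i ->
  [set embed x; z]%SET \in torus_edges -> exists y, z = embed y.
Proof.
move=> xb /torus_edgeP[_ [k [->|xE]]]; first by exists (unit_shift k x); rewrite embed_shift.
have yn j : (z j < n)%N.
  have Ej : nat_of_ord (embed x j) = unit_shift k z j by rewrite xE.
  have := box_interior j xb; rewrite -embedE Ej ffunE; case: eqP => _; last by lia.
  by rewrite ordSE; case: eqP; move: (nat_of_ord (z j)) => a; lia.
by exists [ffun j => Ordinal (yn j)]; apply/ffunP => j; apply: val_inj; rewrite !ffunE.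
Qed.

End Embedding.

(** * Total variation through observables *)

Section TotalVariation.
Context {R : realType} {T U : finType}.
Implicit Types (mu nu h : T -> R).

Lemma expect_law_of (X : T -> U) mu (g : U -> R) : expect (law_of X mu) g = expect mu (g \o X).
Proof.
rewrite /expect /law_of [RHS](partition_big X xpredT)//=; apply: eq_bigr => y _.
by rewrite mulr_suml; apply: eq_bigr => x /eqP ->.
Qed.

Lemma expect_tv mu nu h : (forall x, 0 <= h x <= 1) ->
  expect mu h - expect nu h <= 2 * tv mu nu.
Proof.
move=> h01; rewrite /tv mulrA divff ?pnatr_eq0// mul1r /expect -sumrB.
apply: ler_sum => x _; rewrite -mulrBl; have /andP[h0 h1] := h01 x.
apply: le_trans (ler_norm _) _; rewrite normrM (ger0_norm h0).
by rewrite ler_piMr.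
Qed.

(** The indicator of the set where [mu] exceeds [nu] witnesses the total variation. *)
Lemma tv_le mu nu (b : R) : \sum_x mu x = \sum_x nu x ->
  (forall h, (forall x, 0 <= h x <= 1) -> expect mu h <= expect nu h + b) ->
  tv mu nu <= b.
Proof.
move=> eqm H; pose h x : R := (nu x < mu x)%R%:R.
have h01 x : 0 <= h x <= 1 by rewrite /h; case: (_ < _); rewrite ?lexx ?ler01.
have absE : \sum_x `|mu x - nu x| = (expect mu h - expect nu h) *+ 2.
  rewrite mulr2n -[RHS]subr0 -[in RHS](subrr (\sum_x nu x)) -{1}eqm.
  rewrite /expect -!sumrB -!big_split/= -sumrB; apply: eq_bigr => x _; rewrite /h.
  by case: (ltP (nu x) (mu x)) => xy /=;
    [rewrite gtr0_norm ?subr_gt0//|rewrite ler0_norm ?subr_le0//]; rewrite ?mulr1 ?mulr0; ring.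
rewrite /tv absE -[(_ - _) *+ 2]mulr_natl mulrA mulVf ?pnatr_eq0// mul1r lerBlDl.
exact: H.
Qed.

End TotalVariation.

(** * Dynamics of a phase against dynamics in balls *)

Section PhaseComparison.
Local Open Scope classical_set_scope.
Local Open Scope ring_scope.
Context {R : realType} (d : nat) (p q eps : R) (iota : phase) (n' : nat).
Hypothesis p01 : 0 < p < 1.
Hypothesis q1 : 1 <= q.
Local Notation n := n'.+1.
Local Notation V := (torus d n).
Local Notation E := (@torus_edges d n).
Local Notation Omega := (Omega_phase d eps iota n).
Local Notation Pi := (pi_phase d p q eps iota n).
Hypothesis Omega_neq0 : Omega != finset.set0.
Implicit Types (w : config d n) (A : {set V}) (e : {set V}).

Lemma C1_size_mono w w' : w \subset w' -> (C1_size w <= C1_size w')%N.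
Proof.
move=> ww'; apply/bigmax_leqP => B /imsetP[x xT ->].
apply: (leq_trans _ (leq_bigmax_cond (fk_cluster [set: V] finset.set0 w' x) _)); last first.
  by apply/imsetP; exists x.
apply: subset_leq_card; apply/fintype.subsetP => y; rewrite !inE/=.
exact: connect_linked_mono.
Qed.

Lemma Omega_sub w : w \in Omega -> w \subset E.
Proof. by rewrite inE => /andP[]. Qed.

(** The size of the largest cluster is increasing, so each phase is closed under moves
    towards its extremal configuration. *)
Lemma Omega_up w w' : w \in Omega -> w' \subset E -> phase_le iota w w' -> w' \in Omega.
Proof.
rewrite !inE => /andP[_ wO] ->/=; case: iota wO => /= wO /C1_size_mono; rewrite -(ler_nat R) =>
    le.
  exact: le_trans le wO.
exact: le_trans wO le.
Qed.

Lemma Omega_top : phase_top iota E \in Omega.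
Proof.
have [w wO] := finset.set0Pn _ Omega_neq0.
by apply: (Omega_up wO (phase_top_sub _ _)); apply: phase_le_top; exact: (Omega_sub wO).
Qed.

Lemma extremalE A : extremal iota A = phase_top iota (induced_edges A).
Proof. by case: iota. Qed.

Lemma prob_Omega_gt0 : 0 < prob (@pi_torus R d p q n) Omega.
Proof.
have [w wO] := finset.set0Pn _ Omega_neq0.
rewrite /prob (bigD1 w)//= ltr_wpDr//.
  by apply: sumr_ge0 => v _; exact: rc_ge0.
by rewrite divr_gt0 ?rc_partition_gt0// rc_weight_gt0// Omega_sub.
Qed.

Lemma pi_phase_ge0 w : 0 <= Pi w.
Proof.
rewrite /pi_phase /conditional; case: ifP => // _.
by rewrite divr_ge0 ?rc_ge0// ltW// prob_Omega_gt0.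
Qed.

Lemma pi_phase_sum1 : \sum_w Pi w = 1.
Proof.
rewrite /pi_phase /conditional -big_mkcond/= -mulr_suml divff// gt_eqF//.
exact: prob_Omega_gt0.
Qed.

Lemma pi_phase_supp w : w \notin Omega -> Pi w = 0.
Proof. by rewrite /pi_phase /conditional => /negPf ->. Qed.

Lemma pi_phase_stationary e h : e \in E ->
  \sum_w Pi w * expect (heat_bath (open_prob p q [set: V] finset.set0) Omega e w) h = expect Pi h.
Proof.
move=> eE; pose c := (\sum_w rc_weight p q [set: V] E finset.set0 w)^-1 / prob (@pi_torus R d p
    q n) Omega.
have PiE : Pi = fun w => c * ((w \in Omega)%:R * rc_weight p q [set: V] E finset.set0 w).
  apply/funext => w; rewrite /pi_phase /conditional /c.
  case: ifP => _; last by rewrite mul0r mulr0.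
  by rewrite mul1r /pi_torus /rc; ring.
by rewrite PiE; exact: (rc_stationary p01 q1 _ _ _ _ edges_in_torus eE).
Qed.

Lemma rc_domain_stationary A e h : e \in induced_edges A ->
  \sum_w pi_dom p q iota A w *
    expect (heat_bath (open_prob p q A (bc iota A)) [set: config d n] e w) h =
  expect (pi_dom p q iota A) h.
Proof.
move=> eA; pose c := (\sum_w rc_weight p q A (induced_edges A) (bc iota A) w)^-1.
have PiE : pi_dom p q iota A = fun w => c * ((w \in [set: config d n]%SET)%:R * rc_weight p q A
    (induced_edges A) (bc iota A) w).
  by apply/funext => w; rewrite inE mul1r /pi_dom /rc mulrC.
by rewrite PiE; exact: (rc_stationary p01 q1 _ _ _ _ (@edges_in_induced _ _ A) eA).
Qed.

Lemma agree_setI A e w : e \in induced_edges A ->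
  agree iota e (w :&: induced_edges A) = agree iota e w :> R.
Proof. by move=> eA; case: iota; rewrite /agree inE eA andbT. Qed.

Lemma agree01 e w : 0 <= (agree iota e w : R) <= 1.
Proof. by rewrite /agree; case: iota; case: (e \in w); rewrite ?lexx ?ler01. Qed.

Lemma edge_in_Ball m e : e \in E -> e \in induced_edges (Ball m e).
Proof.
move=> eE; rewrite inE eE; apply/fintype.subsetP => y ye; rewrite inE.
apply/existsP; exists y; rewrite ye; apply/forallP => i.
by rewrite /cyc_dist /cyc_norm subnn min0n.
Qed.

Local Notation fkB A := (idle_outside (induced_edges A) (heat_bath (open_prob p q A (bc iota
    A)) [set: config d n])).

(** An instance of thinning, which puts the dynamics in [A] on the clocks of the torus. *)
Lemma X_law_thin A t w : 0 <= t ->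
  clock_law E (fkB A) (extremal iota A) t w = X_law p q iota A t w.
Proof.
move=> t0; apply: clock_law_thin => //.
- by move=> *; apply: idle_ge0 => *; apply: heat_bath_ge0 => *; exact: open_prob_in_le.
- by move=> *; apply: idle_sum1 => *; exact: heat_bath_sum1.
- by move=> *; exact: fk_update_ge0.
- by move=> *; exact: fk_update_sum1.
- exact: induced_edges_sub.
- by move=> e eA; apply/funext => v; apply/funext => v'; rewrite /idle_outside eA.
- by move=> e v v' _ /negPf eA; rewrite /idle_outside eA.
Qed.

(** Dropping the killing and then forgetting what happens outside [A] only helps the
    edge [e] to agree with the phase. *)
Lemma killed_le_ball A e j : e \in induced_edges A ->
  iter j (step_op E (killed (open_prob p q [set: V] finset.set0) Omega)) (agree iota e)
      (phase_top iota E)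
  <= iter j (step_op E (fkB A)) (agree iota e) (extremal iota A) :> R.
Proof.
move=> eA; have sA := induced_edges_sub A.
apply: le_trans (iter_killed_le_free _ _ _ _ _ _) _.
- by move=> *; exact: open_prob_in_le.
- by move=> *; exact: agree_ge0.
rewrite extremalE -(phase_top_setI iota sA).
rewrite -{1}(_ : (fun w => agree iota e (w :&: induced_edges A)) = agree iota e); last first.
  by apply/funext => w; rewrite agree_setI.
apply: (@iter_idle_compare _ _ iota) => //.
- by apply: open_prob_attractive => //; exact: edges_in_torus.
- by apply: open_prob_attractive => //; exact: edges_in_induced.
- move=> w i iA wE; apply: (@open_prob_domain _ _ R p q iota [set: V]) => //.
  + by move=> B x; rewrite inE.
  + by rewrite induced_edgesT.
- exact: agree_mono.
- exact: phase_top_sub.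
Qed.

(** The Poisson average of [exit_estimate]: the number of rings before [t] has mean
    [#|E| * t], which turns the exit probability per ring into the last term. *)
Theorem phase_comparison m t h : E != finset.set0 -> 0 <= t -> (forall w, 0 <= h w <= 1) ->
  expect (X_phase_law d p q eps iota n t) h <= expect Pi h +
    \sum_(e in E) (expect (X_law p q iota (Ball m e) t) (agree iota e) - expect Pi (agree iota
        e)) +
    (#|E|%:R + 2) * (#|E|%:R * t * prob Pi (Omega_boundary d eps iota n)).
Proof.
move=> E0 t0 h01; set delta := prob _ _.
set r := #|E|%:R * t; have r0 : 0 <= r by rewrite mulr_ge0.
pose s := \sum_(e in E) expect Pi (agree iota e).
pose a e j := iter j (step_op E (fkB (Ball m e))) (agree iota e) (extremal iota (Ball m e)).
pose D := (#|E|%:R + 2) * delta.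
have D0 : 0 <= D.
  by rewrite mulr_ge0 ?addr_ge0// sumr_ge0// => w _; exact: pi_phase_ge0.
have bound j : iter j (step_op E (heat_bath (open_prob p q [set: V] finset.set0) Omega)) h
    (phase_top iota E)
    <= (expect Pi h - s) + \sum_(e in E) a e j + D * j%:R.
  apply: le_trans (exit_estimate _ E0 Omega_sub Omega_up Omega_top pi_phase_ge0
    pi_phase_sum1 pi_phase_supp pi_phase_stationary j h01) _.
    by apply: open_prob_attractive => //; exact: edges_in_torus.
  rewrite sumrB -/s -/delta.
  have : \sum_(e in E) iter j (step_op E (killed (open_prob p q [set: V] finset.set0) Omega))
      (agree iota e) (phase_top iota E) <= \sum_(e in E) a e j.
    by apply: ler_sum => e eE; apply: killed_le_ball; exact: edge_in_Ball.
  have -> : (#|E|%:R + 2) * (j%:R * delta) = D * j%:R by rewrite /D; ring.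
  lra.
have cX := expect_clock_law_cvg (E := E) (x0 := phase_top iota E) (h := h)
  (fk_update_ge0 p01 q1 [set: V] finset.set0 Omega) (@fk_update_sum1 R _ p q _ _ _) t0.
have cB e := expect_clock_law_cvg (E := E) (k := fkB (Ball m e)) (x0 := extremal iota (Ball m e))
  (h := agree iota e)
  (fun i w w' => idle_ge0 _ _ _ _ (fun i w w' => heat_bath_ge0 _ _ _ _ (open_prob_in_le p01 q1
      _ _)))
  (fun i w => idle_sum1 _ _ _ (fun i w => heat_bath_sum1 _ _ _ _)) t0.
have cR : (fun M => (expect Pi h - s) * (\sum_(0 <= j < M) poisson_weight r j) +
    \sum_(e in E) (\sum_(0 <= j < M) poisson_weight r j * a e j) + D * r) @ \oo -->
  (expect Pi h - s) * 1 + \sum_(e in E) expect (X_law p q iota (Ball m e) t) (agree iota e) + D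
      * r.
  apply: cvgD; last exact: cvg_cst.
  apply: cvgD; first by apply: cvgMl_tmp; exact: poisson_weight_cvg.
  apply: cvg_big => [|e _]; first exact: add_continuous.
  have -> : expect (X_law p q iota (Ball m e) t) (agree iota e) =
    expect (clock_law E (fkB (Ball m e)) (extremal iota (Ball m e)) t) (agree iota e) :> R.
    by apply: eq_bigr => w _; rewrite X_law_thin.
  exact: cB.
have -> : X_phase_law d p q eps iota n t =
    clock_law E (fk_update p q [set: V] finset.set0 Omega) (phase_top iota E) t.
  by rewrite /X_phase_law /fk_law extremalE induced_edgesT.
apply: (@le_trans _ _ ((expect Pi h - s) * 1 +
    \sum_(e in E) expect (X_law p q iota (Ball m e) t) (agree iota e) + D * r)); last first.
  by rewrite sumrB -/s /D /r le_eqVlt; apply/orP; left; apply/eqP; ring.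
apply: (ler_cvg_to cX cR); apply: nearW => M.
apply: (@le_trans _ _ (\sum_(0 <= j < M) poisson_weight r j *
   ((expect Pi h - s) + \sum_(e in E) a e j + D * j%:R))).
  by apply: ler_sum => j _; apply: ler_wpM2l; [exact: poisson_weight_ge0|exact: bound].
have -> : \sum_(0 <= j < M) poisson_weight r j * (expect Pi h - s + \sum_(e in E) a e j + D *
    j%:R) =
    (expect Pi h - s) * (\sum_(0 <= j < M) poisson_weight r j) +
    \sum_(e in E) (\sum_(0 <= j < M) poisson_weight r j * a e j) +
    D * (\sum_(0 <= j < M) poisson_weight r j * j%:R).
  rewrite [in RHS]exchange_big/= !mulr_sumr -!big_split/=; apply: eq_bigr => j _.
  by rewrite -mulr_sumr; ring.
by rewrite lerD2l; apply: ler_wpM2l => //; exact: poisson_mean_le.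
Qed.

End PhaseComparison.

(** * Relaxation in balls and mixing in space *)

Section FiniteDomains.
Context {R : realType} (d : nat) (p q : R) (iota : phase).
Hypothesis p01 : 0 < p < 1.
Hypothesis q1 : 1 <= q.

Lemma agree_tv n (e : {set torus d n}) (mu nu : config d n -> R) :
  expect mu (agree iota e) - expect nu (agree iota e) <=
  2 * tv (law_of (fun w : config d n => e \in w) mu) (law_of (fun w : config d n => e \in w) nu).
Proof.
pose g (b : bool) : R := match iota with Wired => b%:R | Free => (~~ b)%:R end.
have gE : agree iota e = g \o (fun w : config d n => e \in w).
  by apply/funext => w; rewrite /agree /g; case: iota.
rewrite gE -!expect_law_of; apply: expect_tv => b.
by rewrite /g; case: iota; case: b; rewrite ?lexx ?ler01.
Qed.

(** The hypothesis only speaks of balls that are logarithmic in the size of the torus,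
    but a ball that does not wrap around is the same graph in every larger torus, and
    in a huge one it is logarithmic. *)
Lemma local_relaxation_all_scales f n' m (e : {set torus d n'.+1}) t :
  local_relaxation d p q iota f -> (m.*2 + 4 <= n'.+1)%N -> 0 < t -> e \in torus_edges ->
  expect (X_law p q iota (Ball m e) t) (agree iota e) <=
  expect (pi_dom p q iota (Ball m e)) (agree iota e) + 2 * expR (- (t / f m)).
Proof.
move=> [A A0 relax] mn t0 eE; have t0' := ltW t0.
have [x [i [eE' xi]]] := torus_edges_pair eE.
(* away from the seam by one more than the radius *)
pose c : torus d n'.+1 := [ffun=> inord m.+1].
have cm j : c j = m.+1 :> nat by rewrite ffunE inordK//; lia.
pose tau := translate (c - x).
have taux : tau x = c by rewrite /tau /translate addrC subrK.
have taue : (tau @: e)%SET = [set c; unit_shift i c]%SET.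
  by rewrite eE' imsetU !imset_set1 /tau translate_shift -/tau taux.
rewrite -(agree_map (@translate_inj d n' (c - x)) iota e).
rewrite -[X in expect _ X <= _]/(agree iota (tau @: e)%SET \o map_sets tau).
rewrite -[X in _ <= expect _ X + _]/(agree iota (tau @: e)%SET \o map_sets tau).
rewrite -(translate_X_law _ _ _ _ _ p01 q1 t0') -translate_pi_dom.
have {}eE : [set c; unit_shift i c]%SET \in torus_edges.
  by rewrite -taux -translate_shift translate_edge -eE'.
rewrite -/tau taue; set e1 := [set c; _]%SET.
have BE : Ball m e1 = box n'.+1 m i by exact: Ball_box.
(* a torus in which a ball of radius m is logarithmic *)
pose N := maxn n'.+1 (Num.bound (expR (m%:R / A))).
have leN : (n'.+1 <= N)%N by exact: leq_maxl.
have mN : m%:R <= A * ln N%:R.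
  rewrite mulrC -ler_pdivrMr// -ler_expR lnK ?posrE ?ltr0n ?(leq_trans _ leN)//.
  apply: (le_trans (ltW (archi_boundP _))); first exact: expR_ge0.
  by rewrite ler_nat leq_maxr.
pose phi := embed leN (d := d).
have phi_inj : injective phi by exact: embed_inj.
have cb : c \in box n'.+1 m i.
  rewrite -BE inE; apply/existsP; exists c; rewrite !inE eqxx; apply/forallP => j.
  by rewrite /cyc_dist /cyc_norm subnn min0n.
have phic j : phi c j = m.+1 :> nat by rewrite embedE.
have phie : (phi @: e1)%SET = [set phi c; unit_shift i (phi c)]%SET.
  by rewrite imsetU !imset_set1 /phi (embed_shift leN mn _ cb).
have BE' : Ball m (phi @: e1)%SET = (phi @: box n'.+1 m i)%SET.
  by rewrite phie (embed_box leN i mn) (Ball_box _ (leq_trans mn leN)).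
have eE'' : (phi @: e1)%SET \in torus_edges.
  by rewrite imsetU !imset_set1 (embed_edge leN mn _ cb).
have N0 : (0 < N)%N by exact: (leq_trans _ leN).
have := relax N m N0 mN t _ t0 eE''.
have := agree_tv (phi @: e1)%SET (X_law p q iota (Ball m (phi @: e1)%SET) t)
  (pi_dom p q iota (Ball m (phi @: e1)%SET)).
rewrite BE' expect_X_law_map ?expect_pi_dom_map//.
- rewrite (_ : _ \o _ = agree iota e1); last exact: agree_map.
  rewrite BE => h1 h2; lra.
- by move=> y y'; exact: embed_edge.
- by move=> y y'; exact: embed_nbr.
- by move=> y y'; exact: embed_edge.
- by move=> y y'; exact: embed_nbr.
Qed.

(** A smaller domain feels its boundary condition more. *)
Lemma pi_dom_holley n' (A A' : {set torus d n'.+1}) e : A' \subset A ->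
  e \in induced_edges A' ->
  expect (pi_dom p q iota A) (agree iota e) <= expect (pi_dom p q iota A') (agree iota e).
Proof.
move=> sA eA'; have sE := induced_edges_mono sA.
rewrite -{1}(_ : (fun w => agree iota e (w :&: induced_edges A')) = agree iota e); last first.
  by apply/funext => w; rewrite agree_setI.
apply: (@holley _ _ iota (induced_edges A) (induced_edges A')
  (open_prob p q A (bc iota A)) (open_prob p q A' (bc iota A'))) => //.
- by apply/finset.set0Pn; exists e; exact: (fintype.subsetP sE).
- by apply: open_prob_attractive => //; exact: edges_in_induced.
- by apply: open_prob_attractive => //; exact: edges_in_induced.
- by move=> w i; exact: open_prob_in.
- move=> w i iA wE; apply: open_prob_domain => //.
  move=> B x BA xB xA'; apply: (boundary_sub sA) => //.
  move: BA xB; case: (iota) => /=; last by rewrite inE => /eqP ->.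
  by case/imsetP => z zA ->; rewrite inE => /eqP ->.
- by move=> w; exact: rc_ge0.
- by move=> w; exact: rc_ge0.
- exact: rc_sum1.
- exact: rc_sum1.
- by move=> w; exact: rc_supp.
- by move=> w; exact: rc_supp.
- by move=> i h iA; exact: rc_domain_stationary.
- by move=> i h iA; exact: rc_domain_stationary.
- exact: agree_mono.
Qed.

(** Translate the edge to the origin and shrink the ball to a box centred there: this
    strengthens the effect of the boundary, and spatial mixing compares the box with
    the phase. *)
Lemma pi_ball_le_phase eps C2 n' m (e : {set torus d n'.+1}) :
  WSM d p q eps iota C2 -> admissible d eps iota n'.+1 ->
  (1 < m)%N -> (m * 4 <= n'.+1)%N -> e \in torus_edges ->
  expect (pi_dom p q iota (Ball m e)) (agree iota e) <=
  expect (pi_phase d p q eps iota n'.+1) (agree iota e) + 2 * (C2 * expR (- ((m * 2)%:R / C2))).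
Proof.
move=> wsm adm m1 mn eE.
have [x [i [eE' xi]]] := torus_edges_pair eE.
pose o : torus d n'.+1 := 0; pose tau := translate (- x).
have taux : tau x = o by rewrite /tau /translate subrr.
have taue : (tau @: e)%SET = [set o; unit_shift i o]%SET.
  by rewrite eE' imsetU !imset_set1 /tau translate_shift -/tau taux.
rewrite -(agree_map (@translate_inj d n' (- x)) iota e).
rewrite -[X in expect _ X <= _]/(agree iota (tau @: e)%SET \o map_sets tau).
rewrite -[X in _ <= expect _ X + _]/(agree iota (tau @: e)%SET \o map_sets tau).
rewrite -translate_pi_dom -translate_pi_phase -/tau taue.
have {}eE : [set o; unit_shift i o]%SET \in torus_edges.
  by rewrite -taux -translate_shift translate_edge -eE'.
set e1 := [set o; _]%SET.
have oj j : o j = 0 :> nat by rewrite /o ffunE.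
have soj j : (unit_shift i o j <= 1)%N.
  by rewrite ffunE; case: eqP => _; rewrite ?ordSE oj//; case: eqP.
have half : (m * 2)%:R / 2 = m%:R :> R by rewrite natrM mulfK.
have LB : Lambda ((m * 2)%:R : R) \subset Ball m e1.
  apply/fintype.subsetP => y; rewrite !inE => /forallP H.
  apply/existsP; exists o; rewrite !inE eqxx; apply/forallP => j; have := H j.
  by rewrite half ler_nat /cyc_dist oj subn0 sub0n addn0.
have eL : e1 \in induced_edges (Lambda ((m * 2)%:R / 2 : R)).
  have m2 : 1 <= m%:R / 2 :> R by rewrite ler_pdivlMr// mul1r ler_nat.
  rewrite mem_induced_edges2 eE /=; apply/andP; split; rewrite inE; apply/forallP => j; rewrite
      half.
    by rewrite oj /cyc_norm min0n; apply: le_trans m2.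
  apply: le_trans m2; rewrite /cyc_norm.
  by rewrite -[leRHS]/(1%:R) ler_nat; apply: leq_trans (geq_minl _ _) (soj j).
have eL' : e1 \in induced_edges (Lambda ((m * 2)%:R : R)).
  apply: (fintype.subsetP (induced_edges_mono _) _ eL); apply/fintype.subsetP => y.
  rewrite !inE => /forallP H; apply/forallP => j; apply: le_trans (H j) _.
  by rewrite half ler_pdivrMr// -natrM ler_nat; lia.
apply: le_trans (pi_dom_holley LB eL') _.
have rn : (m * 2)%:R <= n'.+1%:R / 2 :> R.
  by rewrite ler_pdivlMr// -natrM ler_nat; lia.
have W := wsm _ _ adm rn.
have := @expect_tv R _ (law_of (restrict_to ((m * 2)%:R / 2 : R)) (pi_dom p q iota (Lambda ((m
    * 2)%:R : R) : {set torus d n'.+1})))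
  (law_of (restrict_to ((m * 2)%:R / 2 : R)) (pi_phase d p q eps iota n'.+1)) (agree iota e1)
      (agree01 _ _).
rewrite !expect_law_of (_ : agree iota e1 \o _ = agree iota e1); last first.
  by apply/funext => w; exact: agree_setI.
lra.
Qed.

End FiniteDomains.

(** * The mixing bound *)

Lemma card_torus_edges d n : (#|@torus_edges d n| <= d * n ^ d)%N.
Proof.
pose F (xi : torus d n * 'I_d) := [set xi.1; unit_shift xi.2 xi.1]%SET.
have sub : @torus_edges d n \subset (F @: [set: torus d n * 'I_d])%SET.
  apply/fintype.subsetP => e /torus_edges_pair[x [i [-> _]]].
  by apply/imsetP; exists (x, i).
apply: leq_trans (subset_leq_card sub) _; apply: leq_trans (leq_imset_card _ _) _.
by rewrite cardsT card_prod card_ffun !card_ord mulnC.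
Qed.

Lemma torus_edges_neq0 d n' : (0 < d)%N -> (0 < n')%N -> @torus_edges d n'.+1 != finset.set0.
Proof.
move=> d0 n0; apply/finset.set0Pn; pose i := Ordinal d0; pose x : torus d n'.+1 := [ffun=> ord0].
exists [set x; unit_shift i x]%SET; apply/torus_edgeP; split; last by exists i; left.
apply/eqP => /ffunP/(_ i)/(congr1 (@nat_of_ord _)); rewrite !ffunE eqxx ordSE /=.
by case: eqP => //; lia.
Qed.

(** The left-hand side over the factorial is a Poisson weight. *)
Lemma expR_ge_power {R : realType} (r : R) d : 0 <= r -> r ^+ d * expR (- r) <= d`!%:R.
Proof.
move=> r0; have := poisson_weight_sum_le1 d.+1 r0; rewrite big_nat_recr//= => H.
have : poisson_weight r d <= 1.
  apply: le_trans H; rewrite lerDr; apply: sumr_ge0 => j _; exact: poisson_weight_ge0.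
have F0 : 0 < d`!%:R :> R by rewrite ltr0n fact_gt0.
by rewrite /poisson_weight /exp_coeff/= mulrA ler_pdivrMr// mul1r mulrC.
Qed.

Lemma expect_indicator {R : realType} {T : finType} (mu : T -> R) y :
  expect mu (fun x => (x == y)%:R) = mu y.
Proof.
rewrite /expect (bigD1 y)//= eqxx mulr1 big1 ?addr0// => x /negPf ->.
by rewrite mulr0.
Qed.

Lemma g_leq {R : realType} d (f : nat -> R) K n t : (g_ d f K n t <= n)%N.
Proof. by apply/bigmax_leqP => i _; rewrite -ltnS. Qed.

Lemma g_attained {R : realType} d (f : nat -> R) K n t : (0 < g_ d f K n t)%N ->
  (g_ d f K n t)%:R * f (g_ d f K n t) <= Num.min t (expR (n%:R ^+ d.-1 / K)).
Proof.
pose P (m : 'I_n.+1) := m%:R * f m <= Num.min t (expR (n%:R ^+ d.-1 / K)).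
rewrite /g_ -/(\max_(m < n.+1 | P m) m)%N => g0.
have [m0 Pm0|noP] := pickP P; last by move: g0; rewrite big_pred0.
have [m Pm ->] : {m | m \in P & \max_(m < n.+1 | P m) m = m}%N.
  by apply: eq_bigmax_cond; apply/card_gt0P; exists m0.
exact: Pm.
Qed.

(** The summand 32 makes the bound trivial when [g_] is less than 16; the next two make
    the rate of the bound smaller than the rates of spatial mixing and of the exit
    probability; the last one collects the prefactors of the three error terms. *)
Definition mixing_const {R : realType} (d : nat) (C1 C2 : R) : R :=
  32 + 4 * C2 + 4 * C1 + (2 * d%:R + 2 * C2 * d%:R +
    (d%:R + 2) * d%:R * C1 * ((4 * C1) ^+ d * d`!%:R)).

Section Mixing.
Context {R : realType} (d : nat) (p q eps C1 C2 : R) (iota : phase) (f : nat -> R).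
Hypothesis d2 : (2 <= d)%N.
Hypothesis p01 : 0 < p < 1.
Hypothesis q1 : 1 <= q.
Hypothesis C1_gt0 : 0 < C1.
Hypothesis C2_gt0 : 0 < C2.
Hypothesis f_gt0 : forall m, 0 < f m.
Hypothesis f_nd : forall m m', (m <= m')%N -> f m <= f m'.
Hypothesis stable : exp_stable d p q eps iota C1.
Hypothesis wsm : WSM d p q eps iota C2.
Hypothesis relax : local_relaxation d p q iota f.

Local Notation C0 := (mixing_const d C1 C2).
Local Notation last_terms := (2 * d%:R + 2 * C2 * d%:R +
    (d%:R + 2) * d%:R * C1 * ((4 * C1) ^+ d * d`!%:R)).

Let last_terms_ge0 : 0 <= last_terms.
Proof.
have P0 : 0 <= (4 * C1) ^+ d by rewrite exprn_ge0// mulr_ge0// ltW.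
by rewrite !addr_ge0// ?mulr_ge0// ?addr_ge0// ltW.
Qed.

Let C0_bounds : [/\ 32 <= C0, 4 * C2 <= C0, 4 * C1 <= C0 & last_terms <= C0].
Proof.
have c1 := C1_gt0; have c2 := C2_gt0.
rewrite /mixing_const; move: last_terms last_terms_ge0 => L L0.
by split; lra.
Qed.

Let C0_gt0 : 0 < C0. Proof. by case: C0_bounds => h _ _ _; lra. Qed.

Section FixedTime.
Variables (n' : nat) (t : R).
Local Notation n := n'.+1.
Hypothesis adm : admissible d eps iota n.
Hypothesis t0 : 0 <= t.
Local Notation E := (@torus_edges d n).
Local Notation g := (g_ d f (2 * C1) n t).
Local Notation Pi := (pi_phase d p q eps iota n).

Let Omega_neq0 : Omega_phase d eps iota n != finset.set0. Proof. by case: adm. Qed.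

Lemma X_phase_lawE s : X_phase_law d p q eps iota n s =
  clock_law E (fk_update p q [set: torus d n] finset.set0 (Omega_phase d eps iota n))
      (phase_top iota E) s.
Proof. by rewrite /X_phase_law /fk_law extremalE induced_edgesT. Qed.

Lemma X_phase_law_sum1 s : \sum_w X_phase_law d p q eps iota n s w = 1.
Proof.
rewrite X_phase_lawE; apply: clock_law_sum1 => *; first exact: fk_update_ge0.
exact: fk_update_sum1.
Qed.

Lemma X_phase_law_ge0 s w : 0 <= s -> 0 <= X_phase_law d p q eps iota n s w.
Proof.
move=> s0; rewrite X_phase_lawE; apply: clock_law_ge0 => // *; first exact: fk_update_ge0.
exact: fk_update_sum1.
Qed.

Lemma tv_phase_le1 : tv (X_phase_law d p q eps iota n t) Pi <= 1.
Proof.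
apply: tv_le => [|h h01]; first by rewrite X_phase_law_sum1 pi_phase_sum1.
apply: (@le_trans _ _ (0 + 1)); last first.
  rewrite lerD2r; apply: sumr_ge0 => w _; rewrite mulr_ge0 ?pi_phase_ge0//.
  by case/andP: (h01 w).
rewrite add0r -(X_phase_law_sum1 t); apply: ler_sum => w _.
by rewrite ler_piMr ?X_phase_law_ge0//; case/andP: (h01 w).
Qed.

Lemma tv_phase_nincr s : 0 <= s <= t ->
  tv (X_phase_law d p q eps iota n t) Pi <= tv (X_phase_law d p q eps iota n s) Pi.
Proof.
move=> st; rewrite !X_phase_lawE; apply: tv_clock_law_nincr => //.
- by move=> *; exact: fk_update_ge0.
- by move=> *; exact: fk_update_sum1.
move=> e w eE; have := pi_phase_stationary eps iota p01 q1 (fun x => (x == w)%:R) eE.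
by rewrite expect_indicator; under eq_bigr do rewrite expect_indicator.
Qed.

(** The total variation is at most 1, and the right-hand side is at least 1. *)
Lemma mixing_small : (g < 16)%N ->
  tv (X_phase_law d p q eps iota n t) Pi <= C0 * n%:R ^+ d * expR (- (g%:R / C0)).
Proof.
move=> g16; apply: le_trans tv_phase_le1 _.
have [C32 _ _ _] := C0_bounds.
have X1 : 1 <= n%:R ^+ d :> R by rewrite exprn_ege1// ler1n.
have e2 : 2^-1 <= expR (- (g%:R / C0)).
  apply: le_trans (expR_ge1Dx _); have : g%:R / C0 <= 2^-1; last by lra.
  rewrite ler_pdivrMr//; have : g%:R <= 16 :> R by rewrite ler_nat ltnW.
  lra.
apply: (@le_trans _ _ (32 * 1 * 2^-1)); first by lra.
by apply: ler_pM => //; apply: ler_pM.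
Qed.

(** The bound is read at the time [s], the smaller of [t] and the exit scale, in balls
    of radius [m] close to [G / 4], where [G] is the value of [g_]: they do not wrap
    around, and the boxes of side [m * 2] fit in half of the torus. The definition of
    [g_] makes [s] long enough for the balls to relax up to an error exponentially small
    in [G]. *)
Lemma mixing_large : (16 <= g)%N ->
  tv (X_phase_law d p q eps iota n t) Pi <= C0 * n%:R ^+ d * expR (- (g%:R / C0)).
Proof.
move=> g16; have gn : (g <= n)%N := g_leq d f (2 * C1) n t.
have := g_attained (leq_trans (isT : (0 < 16)%N) g16).
move: g g16 gn => G g16 gn gfs.
have [C32 C0C2 C0C1 C0L] := C0_bounds.
pose y : R := n%:R ^+ d.-1.
pose s := Num.min t (expR (y / (2 * C1))).
rewrite -/y -/s in gfs.
have s0 : 0 < s by apply: lt_le_trans gfs; rewrite mulr_gt0// ltr0n; exact: leq_trans g16.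
have st : s <= t by rewrite /s ge_min lexx.
have sy : s <= expR (y / (2 * C1)) by rewrite /s ge_min lexx orbT.
have st0 : 0 <= s <= t by rewrite st ltW.
apply: le_trans (tv_phase_nincr st0) _.
apply: tv_le => [|h h01]; first by rewrite X_phase_law_sum1 pi_phase_sum1.
have [m m4 m4'] : exists2 m, (m * 4 <= G)%N & (G < m.+1 * 4)%N.
  by exists (G %/ 4)%N; rewrite ?leq_divM ?ltn_ceil.
have [[d0 n0 dn] [m2n m1 [mG G8]]] : [/\ 0 < d, 0 < n' & 1 <= d.-1]%N /\
    [/\ m.*2 + 4 <= n, 1 < m & m <= G /\ G <= 4 * (m * 2)]%N.
  by clear -d2 g16 gn m4 m4'; do ?split; lia.
have E0 : E != finset.set0 := torus_edges_neq0 d0 n0.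
apply: le_trans (phase_comparison p01 q1 Omega_neq0 m E0 (ltW s0) h01) _.
rewrite -addrA lerD2l.
set u := expR (- (G%:R / C0)).
have u0 : 0 < u by exact: expR_gt0.
set X : R := n%:R ^+ d.
have X1 : 1 <= X by rewrite exprn_ege1// ler1n.
pose D : R := d%:R.
have D1 : 1 <= D by rewrite ler1n.
have cE : #|E|%:R <= D * X.
  by rewrite /D /X -natrX -natrM ler_nat; exact: card_torus_edges.
(* f is non-decreasing, so relaxation in the ball is at least as fast as at scale G *)
have e1 : expR (- (s / f m)) <= u.
  rewrite ler_expR lerN2; apply: (@le_trans _ _ G%:R).
    by rewrite ler_pdivrMr// ler_peMr//; lra.
  rewrite ler_pdivlMr//; apply: le_trans gfs; apply: ler_wpM2l => //.
  exact: f_nd.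
have e2 : expR (- ((m * 2)%:R / C2)) <= u.
  rewrite ler_expR lerN2 ler_pdivrMr// mulrAC ler_pdivlMr//.
  have h1 : G%:R <= 4 * (m * 2)%:R :> R by rewrite -natrM ler_nat.
  apply: (@le_trans _ _ (4 * (m * 2)%:R * C2)); first by apply: ler_wpM2r => //; exact: ltW.
  by rewrite mulrC mulrCA mulrA mulrC; apply: ler_wpM2l.
have edge e : e \in E -> expect (X_law p q iota (Ball m e) s) (agree iota e) -
    expect Pi (agree iota e) <= (2 + 2 * C2) * u.
  move=> eE.
  have h1 := local_relaxation_all_scales p01 q1 relax m2n s0 eE.
  have h2 := pi_ball_le_phase p01 q1 wsm adm m1 (leq_trans m4 gn) eE.
  have e2' : C2 * expR (- ((m * 2)%:R / C2)) <= C2 * u by apply: ler_wpM2l => //; exact: ltW.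
  lra.
have sumE : \sum_(e in E) (expect (X_law p q iota (Ball m e) s) (agree iota e) -
    expect Pi (agree iota e)) <= (2 * D + 2 * C2 * D) * (X * u).
  apply: (@le_trans _ _ (#|E|%:R * ((2 + 2 * C2) * u))).
    rewrite mulr_natl -sumr_const; exact: ler_sum.
  have -> : (2 * D + 2 * C2 * D) * (X * u) = (D * X) * ((2 + 2 * C2) * u) by ring.
  by apply: ler_wpM2r => //; rewrite mulr_ge0 ?ltW// addr_gt0// mulr_gt0.
set delta := prob Pi _.
have delta_le : delta <= C1 * expR (- (y / C1)) := stable adm.
have delta0 : 0 <= delta by apply: sumr_ge0 => w _; exact: pi_phase_ge0.
(* At the time s the exit still has half of its exponent left. One half of this
   absorbs a factor n ^ d, the other one is the decay. *)
pose z := expR (- (n%:R / (4 * C1))).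
have z0 : 0 < z by exact: expR_gt0.
have C1_4 : 0 < 4 * C1 by rewrite mulr_gt0.
have zu : z <= u.
  rewrite ler_expR lerN2; apply: (@le_trans _ _ (G%:R / (4 * C1))).
    by apply: ler_wpM2l => //; rewrite lef_pV2 ?posrE.
  by apply: ler_wpM2r; [rewrite invr_ge0 ltW | rewrite ler_nat].
have Xz : X * z <= (4 * C1) ^+ d * d`!%:R.
  have r0 : 0 <= n%:R / (4 * C1) by rewrite divr_ge0// ltW.
  have := expR_ge_power d r0; rewrite -/z expr_div_n mulrAC ler_pdivrMr ?exprn_gt0//.
  by rewrite mulrC [X in _ <= X]mulrC mulrC.
have ny : n%:R <= y.
  by rewrite /y -[leLHS]expr1; apply: ler_weXn2l; rewrite ?ler1n.
have sd : s * delta <= C1 * (z * z).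
  apply: (@le_trans _ _ (expR (y / (2 * C1)) * (C1 * expR (- (y / C1))))).
    by apply: ler_pM => //; exact: ltW.
  rewrite mulrCA; apply: ler_wpM2l; first exact: ltW.
  rewrite -!expRD ler_expR.
  have -> : y / (2 * C1) - y / C1 = - (y / (2 * C1)).
    by field; rewrite gt_eqF.
  have -> : - (n%:R / (4 * C1)) - n%:R / (4 * C1) = - (n%:R / (2 * C1)).
    by field; rewrite gt_eqF.
  by rewrite lerN2; apply: ler_wpM2r; [rewrite invr_ge0 mulr_ge0// ltW | exact: ny].
have exitE : (#|E|%:R + 2) * (#|E|%:R * s * delta) <=
    (D + 2) * D * C1 * ((4 * C1) ^+ d * d`!%:R) * (X * u).
  apply: (@le_trans _ _ (((D + 2) * X) * ((D * X) * (C1 * (z * z))))).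
    apply: ler_pM; rewrite ?addr_ge0// ?mulr_ge0// ?(ltW s0)//.
      by rewrite mulrDl lerD// ler_peMr.
    by rewrite -mulrA; apply: ler_pM => //; rewrite mulr_ge0// ltW.
  have -> : (D + 2) * X * (D * X * (C1 * (z * z))) = (D + 2) * D * C1 * ((X * z) * (X * z)) by
      ring.
  rewrite -[leRHS]mulrA; apply: ler_wpM2l.
    by rewrite !mulr_ge0// ?addr_ge0// ltW.
  have X0 : 0 <= X by apply: le_trans X1.
  apply: ler_pM => //; rewrite ?mulr_ge0// ?(ltW z0)//.
  exact: ler_wpM2l.
apply: (@le_trans _ _ (last_terms * (X * u))).
  by rewrite -/D [leRHS]mulrDl lerD.
rewrite -[leRHS]mulrA; apply: ler_wpM2r => //.
by rewrite mulr_ge0 ?(ltW u0)// (le_trans ler01).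
Qed.

End FixedTime.

Theorem phase_mixing n t : admissible d eps iota n -> 0 <= t ->
  tv (X_phase_law d p q eps iota n t) (pi_phase d p q eps iota n)
  <= C0 * n%:R ^+ d * expR (- ((g_ d f (2 * C1) n t)%:R / C0)).
Proof.
case: n => [[]//|n'] adm t0.
by have [g16|g16] := ltnP (g_ d f (2 * C1) n'.+1 t) 16; [exact: mixing_small|exact: mixing_large].
Qed.

Lemma mixing_const_gt0 : 0 < C0. Proof. exact: C0_gt0. Qed.

End Mixing.

Unset Implicit Arguments.

Theorem theorem1p3 (R : realType) (d : nat) (p q : R) :
  (2 <= d)%N -> 0 < p < 1 -> 1 <= q ->
  exists2 eps0 : R, 0 < eps0 &
  forall eps : R, 0 < eps <= eps0 ->
  forall C1 C2 : R, 0 < C1 -> 0 < C2 ->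
  exists C0 K0 : R, [/\ 0 < C0, 0 < K0,
    forall f : nat -> R,
      (forall m, 0 < f m) -> (forall m m', (m <= m')%N -> f m <= f m') ->
      exp_stable d p q eps Wired C1 ->
      WSM d p q eps Wired C2 ->
      local_relaxation d p q Wired f ->
      forall n, admissible d eps Wired n -> forall t : R, 0 <= t ->
        tv (X_phase_law d p q eps Wired n t) (pi_phase d p q eps Wired n)
        <= C0 * n%:R ^+ d * expR (- ((g_ d f K0 n t)%:R / C0))
  & forall f : nat -> R,
      (forall m, 0 < f m) -> (forall m m', (m <= m')%N -> f m <= f m') ->
      exp_stable d p q eps Free C1 ->
      WSM d p q eps Free C2 ->
      local_relaxation d p q Free f ->
      forall n, admissible d eps Free n -> forall t : R, 0 <= t ->
        tv (X_phase_law d p q eps Free n t) (pi_phase d p q eps Free n)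
        <= C0 * n%:R ^+ d * expR (- ((g_ d f K0 n t)%:R / C0))].
Proof.
move=> d2 p01 q1; exists 1; first exact: ltr01.
move=> eps _ C1 C2 C1_gt0 C2_gt0; exists (mixing_const d C1 C2), (2 * C1); split.
- exact: mixing_const_gt0.
- by rewrite mulr_gt0.
- by move=> f f0 fn st wsm rel n adm t t0; exact: (phase_mixing d2 p01 q1).
- by move=> f f0 fn st wsm rel n adm t t0; exact: (phase_mixing d2 p01 q1).
Qed.
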